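(* Let $K$ be a totally real number field and $m>2$ an even integer. Then there exists a universal $m$-ic form over $K$, i.e., a totally positive definite $m$-ic form with coefficients in $\mathcal{O}_K$ that represents every element of $\mathcal{O}_K^+$.
   Context: An $m$-ic form over $K$ is a homogeneous polynomial of degree $m$ in $n$ variables with coefficients in the ring of integers $\mathcal{O}_K$. It is totally positive definite if for every embedding $\sigma:K\to\mathbb{R}$ the real form $\sigma(Q)$ (apply $\sigma$ to the coefficients) satisfies $\sigma(Q)(x)>0$ for all $x\in\mathbb{R}^n\setminus\{0\}$. $\mathcal{O}_K^+$ is the set of totally positive elements of $\mathcal{O}_K$. $Q$ represents $\alpha$ if $Q(z)=\alpha$ for some $z\in\mathcal{O}_K^n$. *)

(* Defs.v *)
From HB Require Import structures.
From mathcomp Require Import all_boot all_order all_algebra all_field.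
From mathcomp Require Import complex reals.
From mathcomp Require Import mpoly.

Set Implicit Arguments.
Unset Strict Implicit.
Unset Printing Implicit Defensive.

Import Order.TTheory GRing.Theory Num.Theory.
Local Open Scope ring_scope.

(* A number field is a finite extension K : fieldExtType rat, and the field of
   real numbers is an arbitrary R : realType. *)

Definition totally_real (R : realType) (K : fieldExtType rat) : Prop :=
  forall (sigma : {rmorphism K -> R[i]}) (x : K), complex.Im (sigma x) = 0.

(* Membership in the ring of integers of K. *)
Definition in_OK (K : fieldExtType rat) (x : K) : Prop :=
  integralOver (intr : int -> K) x.

Definition in_OK_plus (R : realType) (K : fieldExtType rat) (a : K) : Prop :=
  in_OK a /\ forall sigma : {rmorphism K -> R}, 0 < sigma a.

Definition mic_form (K : fieldExtType rat) (m n : nat) (Q : {mpoly K[n]}) :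
  Prop := Q \is m.-homog /\ forall k : 'X_{1..n}, in_OK Q@_k.

Definition totally_positive_definite (R : realType) (K : fieldExtType rat)
    (n : nat) (Q : {mpoly K[n]}) : Prop :=
  forall (sigma : {rmorphism K -> R}) (x : 'I_n -> R),
    (exists i, x i != 0) -> 0 < (map_mpoly sigma Q).@[x].

Definition represents (K : fieldExtType rat) (n : nat) (Q : {mpoly K[n]})
    (a : K) : Prop :=
  exists z : 'I_n -> K, (forall i, in_OK (z i)) /\ Q.@[z] = a.

Definition universal_mic_form (R : realType) (K : fieldExtType rat)
    (m n : nat) (Q : {mpoly K[n]}) : Prop :=
  [/\ mic_form m Q, totally_positive_definite R Q
    & forall a : K, in_OK_plus R a -> represents Q a].

(* Main.v *)
From HB Require Import structures.
Require Import Defs.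
From mathcomp Require Import all_boot all_order all_algebra all_field.
From mathcomp Require Import complex reals.
From mathcomp Require Import mpoly.
From mathcomp Require Import zify ring lra.
From mathcomp Require boolp.

(* Units of O_K approximate every positive vector t with prod t_i = 1 up to a
   constant, so a totally positive a is e^m g with e a unit and the conjugates
   of g within a bounded ratio of each other. Such a g lies in the monoid
   generated by a finite set D of totally positive integers that depends only
   on K. As Q(e z) = e^m Q(z), it suffices to represent the elements of this
   monoid, and the direct sum over D of delta * F does so as soon as F is a
   positive definite m-ic form over Z representing every natural number.

   For F take
     sum_(i < m) n_i X^i u^(m-1-i) + (m+1) (sum of the squares of all variables)^(m/2),
   in the variables u, X, n_i and four more variables y_1, ..., y_4. Every
   monomial of the first sum is at most (sum of squares)^(m/2) in absolute
   value, hence F is positive definite. For u = 1 and digits n_i < X, Lagrange's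
   theorem provides y with sum of squares equal to (m+2) X^2 whatever the digits
   are, so F takes the value c X^m + r for every r < X^m; this reaches all large
   naturals, and finitely many extra summands v^m reach the small ones. *)

Set Implicit Arguments.
Unset Strict Implicit.
Unset Printing Implicit Defensive.

Import Order.TTheory GRing.Theory Num.Theory.
Local Open Scope ring_scope.

(** * Lagrange's four-square theorem *)

Definition sum4sq (n : int) : Prop :=
  exists a b c d : int, n = a ^+ 2 + b ^+ 2 + c ^+ 2 + d ^+ 2.

(** Euler's identity, that is, multiplicativity of the quaternion norm. The witnesses are the
    coordinates of the second quaternion times the conjugate of the first. *)
Lemma sum4sqM (m n : int) : sum4sq m -> sum4sq n -> sum4sq (m * n).
Proof.
move=> [a [b [c [d ->]]]] [e [f [g [h ->]]]].
exists (a * e + b * f + c * g + d * h), (a * f - b * e + c * h - d * g),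
  (a * g - c * e + d * f - b * h), (a * h - d * e + b * g - c * f).
by ring.
Qed.

Lemma centered_division (k a : int) : 0 < k ->
  exists q r : int, a = k * q + r /\ - k <= r + r <= k.
Proof.
move=> k0; have /= := divz_eq a k; have := ltz_pmod a k0; have := modz_ge0 a (lt0r_neq0 k0).
set q := (a %/ k)%Z; set r := (a %% k)%Z => r0 rk e.
have [h|h] := lerP (r + r) k; [exists q, r | exists (q + 1), (r - k)]; split; nia.
Qed.

Lemma centered_sqr (k r : int) : - k <= r + r <= k -> r ^+ 2 *+ 4 <= k ^+ 2.
Proof.
move=> /andP [h1 h2]; rewrite -subr_ge0.
have -> : k ^+ 2 - r ^+ 2 *+ 4 = (k - (r + r)) * (k + (r + r)) by ring.
by apply: mulr_ge0; lia.
Qed.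

(** Excludes the extreme cases l = 0 and l = k of the descent, in each of which k would divide p. *)
Lemma prime_not_multiple (p : nat) (k c : int) :
  prime p -> 1 < k -> k < p%:Z -> p%:Z <> k * c.
Proof.
move=> pp k1 kp e.
have : (`|k|%N %| p)%N by apply/dvdnP; exists `|c|%N; nia.
by case/primeP: pp => _ h /h /orP [] /eqP; lia.
Qed.

(* Descent: Euler's identity for the product of k p with the sum k l of the squares
   of the centered remainders modulo k has all four entries divisible by k. *)
Lemma sum4sq_descent (p : nat) (k : int) : prime p -> 1 < k -> k < p%:Z ->
  sum4sq (k * p%:Z) -> exists l : int, [/\ 0 < l, l < k & sum4sq (l * p%:Z)].
Proof.
move=> pp k1 kp [x1 [x2 [x3 [x4 e]]]]; have k0 : 0 < k by lia.
have [q1 [r1 [e1 h1]]] := centered_division x1 k0.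
have [q2 [r2 [e2 h2]]] := centered_division x2 k0.
have [q3 [r3 [e3 h3]]] := centered_division x3 k0.
have [q4 [r4 [e4 h4]]] := centered_division x4 k0.
have nm c := @prime_not_multiple p k c pp k1 kp.
have kI : forall u v : int, k * u = k * v -> u = v.
  by move=> u v; apply: mulfI; rewrite gt_eqF.
(* Comes from expanding the sum of the (x_i - k q_i)^2, where the x_i^2 add up to k p, and dividing
   by k. *)
pose l := p%:Z - (x1 * q1 + x2 * q2 + x3 * q3 + x4 * q4) *+ 2
  + k * (q1 ^+ 2 + q2 ^+ 2 + q3 ^+ 2 + q4 ^+ 2).
have el : k * l = r1 ^+ 2 + r2 ^+ 2 + r3 ^+ 2 + r4 ^+ 2.
  rewrite /l mulrDr mulrBr e.
  have -> : r1 = x1 - k * q1 by rewrite e1; ring.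
  have -> : r2 = x2 - k * q2 by rewrite e2; ring.
  have -> : r3 = x3 - k * q3 by rewrite e3; ring.
  have -> : r4 = x4 - k * q4 by rewrite e4; ring.
  by ring.
have sqE (r : int) : r ^+ 2 *+ 4 = k ^+ 2 -> exists s, r *+ 2 = k * s.
  move=> er; have /eqP : (r *+ 2 - k) * (r *+ 2 + k) = 0.
    by apply/eqP; rewrite -subr_sqr -er subr_eq0; apply/eqP; ring.
  rewrite mulf_eq0 subr_eq0 addr_eq0 => /orP [] /eqP ->; [exists 1|exists (-1)]; ring.
have s1 := centered_sqr h1; have s2 := centered_sqr h2.
have s3 := centered_sqr h3; have s4 := centered_sqr h4.
have l_ge0 : 0 <= l by rewrite -(pmulr_rge0 _ k0) el !addr_ge0 ?sqr_ge0.
have l_le : l <= k.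
  by rewrite -(ler_pM2l k0) el -expr2; lra.
have [l0|lN0] := eqVneq l 0.
  exfalso; have z (r : int) : r ^+ 2 = 0 -> r = 0 by move/eqP; rewrite sqrf_eq0 => /eqP.
  have : r1 ^+ 2 = 0 /\ r2 ^+ 2 = 0 /\ r3 ^+ 2 = 0 /\ r4 ^+ 2 = 0.
    move: el; rewrite l0 mulr0; have := sqr_ge0 r1; have := sqr_ge0 r2.
    by have := sqr_ge0 r3; have := sqr_ge0 r4; split; [|split; [|split]]; lra.
  case=> /z z1 [/z z2 [/z z3 /z z4]].
  apply: (nm (q1 ^+ 2 + q2 ^+ 2 + q3 ^+ 2 + q4 ^+ 2)); apply: kI.
  by rewrite e e1 e2 e3 e4 z1 z2 z3 z4; ring.
(* For l = k every r_i is k/2 up to sign, so k^2 again divides the sum of the x_i^2. *)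
have [lk|lNk] := eqVneq l k.
  exfalso; move: el; rewrite lk -expr2 => el.
  have : [/\ r1 ^+ 2 *+ 4 = k ^+ 2, r2 ^+ 2 *+ 4 = k ^+ 2, r3 ^+ 2 *+ 4 = k ^+ 2
    & r4 ^+ 2 *+ 4 = k ^+ 2] by split; lra.
  case=> /sqE [t1 z1] /sqE [t2 z2] /sqE [t3 z3] /sqE [t4 z4].
  apply: (nm (q1 ^+ 2 + q2 ^+ 2 + q3 ^+ 2 + q4 ^+ 2 + 1
    + (q1 * t1 + q2 * t2 + q3 * t3 + q4 * t4))); apply: kI.
  rewrite e e1 e2 e3 e4.
  transitivity (k * (k * (q1 ^+ 2 + q2 ^+ 2 + q3 ^+ 2 + q4 ^+ 2))
    + (r1 ^+ 2 + r2 ^+ 2 + r3 ^+ 2 + r4 ^+ 2)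
    + k * (q1 * (r1 *+ 2) + q2 * (r2 *+ 2) + q3 * (r3 *+ 2) + q4 * (r4 *+ 2))).
    by ring.
  by rewrite -el z1 z2 z3 z4; ring.
exists l; split; [lia | lia |].
(* Entries of Euler's product of the x_i and the r_i, divided by k after substituting x_i = k q_i +
   r_i. *)
exists (q1 * r1 + q2 * r2 + q3 * r3 + q4 * r4 + l),
  (q1 * r2 - q2 * r1 + q3 * r4 - q4 * r3),
  (q1 * r3 - q3 * r1 + q4 * r2 - q2 * r4),
  (q1 * r4 - q4 * r1 + q2 * r3 - q3 * r2).
apply: (kI _ _ _); apply: (kI _ _ _); transitivity ((k * l) * (k * p%:Z)); first by ring.
transitivity ((k * (q1 * r1 + q2 * r2 + q3 * r3 + q4 * r4) + k * l) ^+ 2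
  + (k * (q1 * r2 - q2 * r1 + q3 * r4 - q4 * r3)) ^+ 2
  + (k * (q1 * r3 - q3 * r1 + q4 * r2 - q2 * r4)) ^+ 2
  + (k * (q1 * r4 - q4 * r1 + q2 * r3 - q3 * r2)) ^+ 2); last by ring.
by rewrite el e e1 e2 e3 e4; ring.
Qed.

(** A square has at most two roots and p is odd, so more than half of the residues modulo p are
    squares. Hence the set of squares meets its image under y -> -1 - y. *)
Lemma sqr_add_sqr_add1 (p : nat) : prime p -> odd p ->
  exists x y c : int, x ^+ 2 + y ^+ 2 + 1 = p%:Z * c.
Proof.
move=> pp op; pose S := [set x ^+ 2 | x : 'F_p]; pose T := [set - 1 - y | y in S].
have cT : #|T| = #|S| by rewrite card_imset // => x y /addrI /oppr_inj.
have cS : (p <= 2 * #|S|)%N.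
  rewrite -{1}(card_Fp pp) -cardsT mulnC.
  rewrite -[leqLHS](@card_in_imset _ _ id) //.
  have -> : #|[set id x | x in [set: 'F_p]]| =
    (\sum_(y in S) #|[set x : 'F_p | x ^+ 2 == y]|)%N.
    rewrite imset_id -sum1_card (partition_big (fun x => x ^+ 2) (mem S)) /=.
      by apply: eq_bigr => y yS; rewrite -sum1_card; apply: eq_bigl => x; rewrite !inE.
    by move=> x _; apply: imset_f.
  rewrite -sum_nat_const leq_sum // => _ /imsetP [x _ ->].
  apply: (@leq_trans #|[set x; - x]|); last by rewrite cards2; case: (_ != _).
  by apply/subset_leq_card/subsetP => z; rewrite !inE eqf_sqr.
have : (0 < #|S :&: T|)%N.
  have := cardsUI S T; have : (#|S :|: T| <= p)%N by rewrite -[leqRHS](card_Fp pp) max_card.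
  by rewrite cT; move: op cS; lia.
case/card_gt0P => z; rewrite inE => /andP [/imsetP [x _ ->]] /imsetP [_ /imsetP [y _ ->]] e.
have e2 : (((x : nat) ^ 2 + (y : nat) ^ 2 + 1)%N%:R = 0 :> 'F_p).
  rewrite !natrD !natrX !natr_Zp e; ring.
move/eqP: e2; rewrite -(dvdn_pcharf (pchar_Fp pp)) => /dvdnP [c e2].
exists x%:Z, y%:Z, c%:Z; nia.
Qed.

(** Centering x and y in x^2 + y^2 + 1 = p c gives a multiple k p that is a sum of four squares,
    with k < p because centered squares are at most p^2/4. Descent then lowers k to 1. *)
Lemma sum4sq_prime (p : nat) : prime p -> sum4sq p%:Z.
Proof.
move=> pp; have p1 := prime_gt1 pp.
have [p2|podd] := even_prime pp; first by rewrite p2; exists 1, 1, 0, 0.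
have [k [k0 kp]] : exists k : int, [/\ 0 < k, k < p%:Z & sum4sq (k * p%:Z)].
  have [x [y [c e]]] := sqr_add_sqr_add1 pp podd.
  have p0 : 0 < p%:Z by lia.
  have [q [r [eq hr]]] := centered_division x p0.
  have [q' [r' [eq' hr']]] := centered_division y p0.
  have ek : (c - p%:Z * (q ^+ 2 + q' ^+ 2) - (q * r + q' * r') *+ 2) * p%:Z =
    r ^+ 2 + r' ^+ 2 + 1 ^+ 2 + 0 ^+ 2.
    by rewrite !mulrBl [c * _]mulrC -e eq eq'; ring.
  set k := (X in X * _) in ek; exists k.
  have := centered_sqr hr; have := centered_sqr hr'; have := sqr_ge0 r.
  have := sqr_ge0 r' => r0 r0' h h'.
  split; last by exists r, r', 1, 0.
    by rewrite -(pmulr_lgt0 _ p0) ek; lra.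
  rewrite -(ltr_pM2r p0) ek -expr2.
  have : 2 ^+ 2 <= p%:Z ^+ 2 by rewrite lerXn2r ?nnegrE //; lia.
  by lra.
case: k k0 kp => // n; rewrite ltz_nat => n0.
have [N nN] := ubnP n; elim: N => // N IH in n n0 nN * => np s.
have [n1|n1] := eqVneq n 1%N; first by move: s; rewrite n1 mul1r.
have [| [l|l] [l0 ln sl]] // := @sum4sq_descent p n%:Z pp _ np s; first lia.
apply: (IH l) => //; lia.
Qed.

Lemma lagrange_four_squares (n : nat) : sum4sq n%:Z.
Proof.
elim/ltn_ind: n => n IH; case: (leqP n 1) => [|n1].
  by case: n {IH} => [|[]] // _; [exists 0, 0, 0, 0 | exists 1, 0, 0, 0].
have /dvdnP [q e] := pdiv_dvd n; have pp := pdiv_prime n1.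
rewrite e PoszM; apply: sum4sqM; last exact: sum4sq_prime.
by apply: IH; have := prime_gt1 pp; nia.
Qed.

(** * Sums, multiples and values of m-ic forms *)

Section IntegralElements.
Variable K : fieldExtType rat.
Implicit Types x y : K.

Lemma in_OK_int (a : int) : in_OK (a%:~R : K).
Proof. exact: (integral_id intr). Qed.

Lemma in_OK_nat (a : nat) : in_OK (a%:R : K).
Proof. exact: (in_OK_int a). Qed.

Lemma in_OKD x y : in_OK x -> in_OK y -> in_OK (x + y).
Proof. exact: (integral_add (RtoK := intr)). Qed.

Lemma in_OKB x y : in_OK x -> in_OK y -> in_OK (x - y).
Proof. exact: (integral_sub (RtoK := intr)). Qed.

Lemma in_OKM x y : in_OK x -> in_OK y -> in_OK (x * y).
Proof. exact: (integral_mul (RtoK := intr)). Qed.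

Lemma in_OKX x k : in_OK x -> in_OK (x ^+ k).
Proof.
move=> ox; elim: k => [|k IH]; first exact: (in_OK_nat 1).
by rewrite exprS; apply: in_OKM.
Qed.

Lemma in_OK_sum (I : Type) (r : seq I) (P : pred I) (F : I -> K) :
  (forall i, P i -> in_OK (F i)) -> in_OK (\sum_(i <- r | P i) F i).
Proof.
by move=> oF; apply: big_ind => //; [exact: (in_OK_nat 0) | exact: in_OKD].
Qed.

End IntegralElements.

Section IntegralCoefficients.
Variable (K : fieldExtType rat).

Definition integral_coefs (n : nat) (p : {mpoly K[n]}) : Prop :=
  forall k : 'X_{1..n}, in_OK p@_k.

Variable n : nat.
Implicit Types p q : {mpoly K[n]}.

Lemma integral_coefsC (c : K) : in_OK c -> integral_coefs (c%:MP : {mpoly K[n]}).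
Proof. by move=> oc k; rewrite mcoeffC; apply: in_OKM => //; exact: in_OK_nat. Qed.

Lemma integral_coefsX i : integral_coefs ('X_i : {mpoly K[n]}).
Proof. by move=> k; rewrite mcoeffX; exact: in_OK_nat. Qed.

Lemma integral_coefsD p q : integral_coefs p -> integral_coefs q -> integral_coefs (p + q).
Proof. by move=> op oq k; rewrite mcoeffD; apply: in_OKD. Qed.

Lemma integral_coefsM p q : integral_coefs p -> integral_coefs q -> integral_coefs (p * q).
Proof. by move=> op oq k; rewrite mcoeffM; apply: in_OK_sum => i _; apply: in_OKM. Qed.

Lemma integral_coefsZ c p : in_OK c -> integral_coefs p -> integral_coefs (c *: p).
Proof. by move=> oc op k; rewrite mcoeffZ; apply: in_OKM. Qed.

Lemma integral_coefs_exp p a : integral_coefs p -> integral_coefs (p ^+ a).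
Proof.
move=> op; elim: a => [|a IH]; last by rewrite exprS; apply: integral_coefsM.
by rewrite expr0 -mpolyC1; apply: integral_coefsC; exact: (in_OK_nat _ 1).
Qed.

Lemma integral_coefs_sum (I : Type) (r : seq I) (P : pred I) (F : I -> {mpoly K[n]}) :
  (forall i, P i -> integral_coefs (F i)) -> integral_coefs (\sum_(i <- r | P i) F i).
Proof.
move=> oF; apply: big_ind => //; last exact: integral_coefsD.
by move=> k; rewrite mcoeff0; exact: (in_OK_nat _ 0).
Qed.

End IntegralCoefficients.

Lemma map_mpoly_mevalE (K L : fieldType) (s : {rmorphism K -> L}) (n : nat)
    (p : {mpoly K[n]}) (v : 'I_n -> L) :
  (map_mpoly s p).@[v] = \sum_(m <- msupp p) s p@_m * \prod_(i < n) v i ^+ m i.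
Proof.
have -> : map_mpoly s p = \sum_(m <- msupp p) s p@_m *: 'X_[m].
  rewrite [in LHS](mpolyE p) raddf_sum; apply: eq_bigr => m _.
  by rewrite [LHS]map_mpolyZ map_mpolyX.
rewrite raddf_sum; apply: eq_bigr => m _; rewrite [LHS]mevalZ; congr (_ * _).
exact: mevalX.
Qed.

Section Renaming.
Variables (K : fieldExtType rat) (n k : nat) (h : 'I_n -> 'I_k).

(** Together with [lshift] and [rshift] it moves two forms into disjoint sets of variables, as
    direct sums require. *)
Definition rename (p : {mpoly K[n]}) : {mpoly K[k]} :=
  p \mPo [tuple 'X_(h i) | i < n].

Lemma renameE p :
  rename p = \sum_(m <- msupp p) p@_m *: \prod_(i < n) 'X_(h i) ^+ m i.
Proof.
rewrite /rename comp_mpolyE; apply: eq_bigr => m _; congr (_ *: _).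
by apply: eq_bigr => i _; rewrite tnth_mktuple.
Qed.

Lemma rename_mic m p : mic_form m p -> mic_form m (rename p).
Proof.
move=> [hp op]; rewrite renameE; split.
  rewrite big_seq; apply: (big_ind (fun q => q \is m.-homog)) => [||u um].
  - exact: dhomog0.
  - by move=> ? ?; exact: dhomogD.
  apply: dhomogZ; have <- : mdeg u = m := dhomog_mf hp um.
  rewrite mdegE.
  apply: (big_ind2 (fun (q : {mpoly K[k]}) d => q \is d.-homog)) => [||i _].
  - exact: dhomog1.
  - by move=> ? ? ? ?; exact: dhomogM.
  rewrite -[X in X.-homog]mul1n; apply: dhomogMn; rewrite dhomogX.
  by apply/eqP; exact: mdeg1.
apply: integral_coefs_sum => u _; apply: integral_coefsZ; first exact: op.
apply: (big_ind (@integral_coefs K k)) => [||i _].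
- exact: (integral_coefs_exp 0 (integral_coefsC (in_OK_nat _ 0))).
- exact: integral_coefsM.
- by apply: integral_coefs_exp; exact: integral_coefsX.
Qed.

Lemma rename_meval p (v : 'I_k -> K) : (rename p).@[v] = p.@[v \o h].
Proof.
by rewrite comp_mpoly_meval; apply: meval_eq => i; rewrite tnth_mktuple mevalXU.
Qed.

Lemma rename_map_meval (L : fieldType) (s : {rmorphism K -> L}) p (v : 'I_k -> L) :
  (map_mpoly s (rename p)).@[v] = (map_mpoly s p).@[v \o h].
Proof.
rewrite [RHS]map_mpoly_mevalE.
have -> : map_mpoly s (rename p) =
    \sum_(m <- msupp p) s p@_m *: \prod_(i < n) 'X_(h i) ^+ m i.
  rewrite renameE raddf_sum; apply: eq_bigr => m _; rewrite [LHS]map_mpolyZ; congr (_ *: _).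
  rewrite rmorph_prod; apply: eq_bigr => i _; rewrite rmorphXn.
  by congr (_ ^+ _); exact: map_mpolyX.
rewrite raddf_sum; apply: eq_bigr => m _; rewrite [LHS]mevalZ; congr (_ * _).
by rewrite rmorph_prod; apply: eq_bigr => i _; rewrite rmorphXn; congr (_ ^+ _); exact: mevalXU.
Qed.

End Renaming.

(** The form and its number of variables are hidden, so that the closure properties below only track
    which values are represented. *)
Definition form_representing (R : realType) (K : fieldExtType rat) (m : nat)
    (P : K -> Prop) : Prop :=
  exists (n : nat) (Q : {mpoly K[n]}), [/\ mic_form m Q,
    totally_positive_definite R Q & forall a, P a -> represents Q a].

Section FormRepresenting.
Variables (R : realType) (K : fieldExtType rat) (m : nat).
Hypothesis m_gt0 : (0 < m)%N.
Implicit Types P : K -> Prop.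

Lemma map_form_eval0 (n : nat) (Q : {mpoly K[n]}) (L : fieldType)
    (s : {rmorphism K -> L}) (v : 'I_n -> L) :
  mic_form m Q -> (forall i, v i = 0) -> (map_mpoly s Q).@[v] = 0.
Proof.
move=> [hQ _] v0; rewrite map_mpoly_mevalE big_seq big1 // => u um.
have : (0 < \sum_i u i)%N by rewrite -mdegE [mdeg u](dhomog_mf hQ um).
have [i /= ui _|u0] := pickP (fun i => u i != 0%N); last first.
  by rewrite big1 // => i _; apply/eqP; rewrite -[_ == _]negbK u0.
by rewrite (bigD1 i) //= v0 expr0n (negbTE ui) mul0r mulr0.
Qed.

Lemma form_representing_mono P1 P2 : (forall a, P1 a -> P2 a) ->
  form_representing R m P2 -> form_representing R m P1.
Proof. by move=> h [n [Q [a b c]]]; exists n, Q; split=> // x /h /c. Qed.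

(** The zero form in no variables is positive definite vacuously. *)
Lemma form_representing0 : form_representing R m (fun a : K => a = 0).
Proof.
exists 0%N, 0; split.
- by split=> [|k]; [exact: dhomog0 | rewrite mcoeff0; exact: (in_OK_nat _ 0)].
- by move=> s x [[]].
- by move=> _ ->; exists (fun _ => 0); split=> [[]|] //; rewrite meval0.
Qed.

(** The direct sum works: a nonzero vector is nonzero on one block, and the other block contributes
    a nonnegative value. *)
Lemma form_representingD P1 P2 :
  form_representing R m P1 -> form_representing R m P2 ->
  form_representing R m (fun a => exists b c, [/\ P1 b, P2 c & a = b + c]).
Proof.
move=> [n1 [Q1 [f1 t1 r1]]] [n2 [Q2 [f2 t2 r2]]].
exists (n1 + n2)%N, (rename (@lshift n1 n2) Q1 + rename (@rshift n1 n2) Q2).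
have [h1 o1] := rename_mic (@lshift n1 n2) f1.
have [h2 o2] := rename_mic (@rshift n1 n2) f2.
split; first by split; [exact: dhomogD | exact: integral_coefsD].
- move=> s x [i xi]; rewrite rmorphD rmorphD /= !rename_map_meval.
  have nn (k : nat) (Q : {mpoly K[k]}) v : mic_form m Q -> totally_positive_definite R Q ->
      0 <= (map_mpoly s Q).@[v].
    move=> fQ tQ; case: (boolP [exists j, v j != 0]) => [/existsP /tQ -/(_ s) /ltW //|].
    rewrite negb_exists => /forallP v0; rewrite map_form_eval0 // => j.
    by apply/eqP; rewrite -[_ == _]negbK v0.
  rewrite -(splitK i) in xi; case: (split i) xi => j /= xj.
    by apply: ltr_pwDl; [apply: t1; exists j | exact: nn].
  by apply: ltr_wpDl; [exact: nn | apply: t2; exists j].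
- move=> _ [b [c [/r1 [z1 [oz1 <-]] /r2 [z2 [oz2 <-]] ->]]].
  exists (fun i => match split i with inl j => z1 j | inr j => z2 j end); split.
    by move=> i; case: (split i).
  rewrite mevalD !rename_meval; congr (_ + _); apply: meval_eq => j /=.
    by rewrite (unsplitK (inl j)).
  by rewrite (unsplitK (inr j)).
Qed.

Lemma form_representingZ (d : K) P : in_OK_plus R d ->
  form_representing R m P -> form_representing R m (fun a => exists2 b, P b & a = d * b).
Proof.
move=> [od dpos] [n [Q [[hQ oQ] tQ rQ]]]; exists n, (d *: Q); split.
- by split; [exact: dhomogZ | exact: integral_coefsZ].
- by move=> s x xi; rewrite map_mpolyZ mevalZ; apply: mulr_gt0 (dpos s) (tQ s x xi).
- by move=> _ [b /rQ [z [oz <-]] ->]; exists z; split=> //; rewrite mevalZ.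
Qed.

Lemma represents_scale (n : nat) (Q : {mpoly K[n]}) (a e : K) :
  mic_form m Q -> in_OK e -> represents Q a -> represents Q (e ^+ m * a).
Proof.
move=> [hQ _] oe [z [oz <-]]; exists (fun i => e * z i); split.
  by move=> i; exact: in_OKM.
rewrite !mevalE big_distrr /= big_seq [RHS]big_seq.
apply: eq_bigr => u um; rewrite mulrCA; congr (_ * _).
have <- : mdeg u = m := dhomog_mf hQ um.
rewrite mdegE -prodrXr -big_split /=.
by apply: eq_bigr => i _; rewrite exprMn.
Qed.

Lemma form_representing_pow :
  ~~ odd m -> form_representing R m (fun a : K => exists2 z, in_OK z & a = z ^+ m).
Proof.
move=> ev; exists 1%N, ('X_ord0 ^+ m); split.
- split; last by apply: integral_coefs_exp; exact: integral_coefsX.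
  rewrite -[X in X.-homog]mul1n; apply: dhomogMn; rewrite dhomogX.
  by apply/eqP; exact: mdeg1.
- move=> s x [i xi]; rewrite (ord1 i) in xi.
  have -> : (map_mpoly s ('X_ord0 ^+ m)).@[x] = x ord0 ^+ m.
    rewrite !rmorphXn; congr (_ ^+ _); transitivity ('X_ord0 : {mpoly R[1]}).@[x].
      by congr (_.@[_]); exact: map_mpolyX.
    exact: mevalXU.
  by rewrite lt0r expf_neq0 //= exprn_even_ge0.
- move=> _ [z oz ->]; exists (fun _ => z); split=> //.
  by rewrite rmorphXn; congr (_ ^+ _); exact: mevalXU.
Qed.

Lemma form_representing_combinations (s : seq K) P :
  (forall d, d \in s -> in_OK_plus R d) -> form_representing R m P ->
  form_representing R m
    (fun a => exists c : K -> K, (forall d, P (c d)) /\ a = \sum_(d <- s) d * c d).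
Proof.
move=> + fP; elim: s => [|d s IH] sP.
  apply: form_representing_mono form_representing0.
  by move=> a [c [_ ->]]; rewrite big_nil.
have {}IH := IH (fun e es => sP e (mem_behead (s := d :: s) es)).
have fd := form_representingZ (sP d (mem_head d s)) fP.
apply: form_representing_mono (form_representingD fd IH) => a [c [cP ->]].
exists (d * c d), (\sum_(e <- s) e * c e); split; last by rewrite big_cons.
  by exists (c d).
by exists c.
Qed.

End FormRepresenting.

(** * A form over Z representing every natural number *)

Lemma base_digits (b m r : nat) : (0 < b)%N -> (r < b ^ m)%N ->
  exists f : nat -> nat, (forall i, (f i < b)%N) /\ r = (\sum_(i < m) f i * b ^ i)%N.
Proof.
move=> b0; elim: m r => [|m IH] r hr.
  by exists (fun _ => 0%N); split=> //; rewrite big_ord0; case: r hr.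
have [|f [fb e]] := IH (r %/ b)%N; first by rewrite ltn_divLR // mulnC -expnS.
exists (fun i => if i is j.+1 then f j else (r %% b)%N); split.
  by case=> [|i] //; rewrite ltn_mod.
rewrite big_ord_recl muln1 {1}(divn_eq r b) addnC; congr (_ + _)%N.
rewrite e big_distrl /=; apply: eq_bigr => i _.
by rewrite /bump /= add1n expnS mulnCA mulnC.
Qed.

(** This is (X+1)^m - X^m <= (2^m - 1) X^(m-1), multiplied by X and freed of subtraction. *)
Lemma exp_succ_bound (m X : nat) : (0 < X)%N ->
  (X.+1 ^ m * X + X ^ m <= X ^ m * (X + 2 ^ m))%N.
Proof.
move=> X0; elim: m => [|m IH]; first by rewrite !expn0; lia.
rewrite !expnS; move: IH; set u := (X.+1 ^ m)%N; set v := (X ^ m)%N; set w := (2 ^ m)%N.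
move=> IH; have w0 : (0 < w)%N by rewrite expn_gt0.
apply: (@leq_trans (X.+1 * (v * (X + w)) - X.+1 * v + X * v)%N).
  by have := leq_mul (leqnn X.+1) IH; nia.
have : (v * w <= v * w * X)%N by rewrite leq_pmulr.
by nia.
Qed.

(** Take the largest X with c X^m <= n. Once X >= c 2^m, the gap c (X+1)^m - c X^m is at most X^m,
    so the remainder n - c X^m has m digits in base X. *)
Lemma power_plus_digits (m c : nat) : (0 < m)%N -> (0 < c)%N ->
  exists n0, forall n, (n0 <= n)%N ->
  exists (X : nat) (f : nat -> nat), [/\ (0 < X)%N, forall i, (f i < X)%N
    & n = (c * X ^ m + \sum_(i < m) f i * X ^ i)%N].
Proof.
move=> m0 c0; pose X0 := (c * 2 ^ m)%N; exists (c * X0 ^ m)%N => n hn.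
have X0_gt0 : (0 < X0)%N by rewrite muln_gt0 c0 expn_gt0.
have ub X : (c * X ^ m <= n)%N -> (X <= n)%N.
  apply: leq_trans; apply: leq_trans (leq_pmull _ c0); case: (X) m0 => // X' m0.
  by rewrite -{1}(expn1 X'.+1) leq_pexp2l.
have ex : exists X, (c * X ^ m <= n)%N by exists X0.
case: (ex_maxnP ex ub) => X hX maxX; have XX0 := maxX _ hn.
have X_gt0 : (0 < X)%N by apply: leq_trans XX0.
have lt : (n < c * X.+1 ^ m)%N by rewrite ltnNge; apply/negP => /maxX; rewrite ltnn.
have [|f [fX e]] := @base_digits X m (n - c * X ^ m) X_gt0; last first.
  by exists X, f; split=> //; rewrite -e subnKC.
suff : (c * X.+1 ^ m <= c * X ^ m + X ^ m)%N by lia.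
rewrite -(leq_pmul2r X_gt0).
have := exp_succ_bound m X_gt0; move: XX0; rewrite /X0.
set u := (X.+1 ^ m)%N; set v := (X ^ m)%N; set w := (2 ^ m)%N => h1 h2.
have : (c * (u * X + v) <= c * (v * (X + w)))%N by rewrite leq_mul.
have : (v * (c * w) <= v * X)%N by rewrite leq_mul.
by nia.
Qed.

(** Each of the m factors has absolute value at most sqrt S, and (sqrt S)^m = S^(m/2) for even m. *)
Lemma monomial_bound (R : rcfType) (m i : nat) (S a b c : R) : ~~ odd m -> (i < m)%N ->
  a ^+ 2 <= S -> b ^+ 2 <= S -> c ^+ 2 <= S ->
  - S ^+ m./2 <= a * b ^+ i * c ^+ (m.-1 - i).
Proof.
move=> ev im ha hb hc; have S0 : 0 <= S by apply: le_trans ha; exact: sqr_ge0.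
have le_sqrt x : x ^+ 2 <= S -> `|x| <= Num.sqrt S.
  by move=> hx; rewrite -sqrtr_sqr ler_sqrt.
have -> : S ^+ m./2 = Num.sqrt S * Num.sqrt S ^+ i * Num.sqrt S ^+ (m.-1 - i).
  rewrite -{1}(sqr_sqrtr S0) -exprM mul2n (even_halfK ev) -exprS -exprD.
  by congr (_ ^+ _); lia.
rewrite lerNl; apply: le_trans (ler_norm _) _; rewrite normrN !normrM !normrX.
by rewrite !ler_pM ?mulr_ge0 ?exprn_ge0 ?lerXn2r ?nnegrE ?sqrtr_ge0 ?le_sqrt.
Qed.

Section UniversalForNaturals.
Variables (R : realType) (K : fieldExtType rat) (m : nat).
Hypotheses (m_gt0 : (0 < m)%N) (m_even : ~~ odd m).

(* The variables are, in this order, u, X, y_1, ..., y_4 and n_0, ..., n_(m-1). *)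
Definition digit_form : {mpoly K[6 + m]} :=
  \sum_(i < m) 'X_(rshift 6 i) * 'X_(lshift m 1) ^+ i * 'X_(lshift m 0) ^+ (m.-1 - i)
  + m.+1%:R *: (\sum_j 'X_j ^+ 2) ^+ m./2.

(** A common target for evaluation in K and evaluation after a real embedding. *)
Definition digit_form_fun (L : fieldType) (x : 'I_(6 + m) -> L) : L :=
  \sum_(i < m) x (rshift 6 i) * x (lshift m 1) ^+ i * x (lshift m 0) ^+ (m.-1 - i)
  + m.+1%:R * (\sum_j x j ^+ 2) ^+ m./2.

Lemma map_digit_form (L : fieldType) (s : {rmorphism K -> L}) (x : 'I_(6 + m) -> L) :
  (map_mpoly s digit_form).@[x] = digit_form_fun x.
Proof.
have sX i : map_mpoly s 'X_i = 'X_i := map_mpolyX _ _.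
have vX i : ('X_i : {mpoly L[6 + m]}).@[x] = x i := mevalXU _ _.
rewrite /digit_form /digit_form_fun (rmorphD (map_mpoly s)) (rmorphD (meval x)).
congr (_ + _).
  rewrite (rmorph_sum (map_mpoly s)) (rmorph_sum (meval x)); apply: eq_bigr => i _.
  rewrite !(rmorphM (map_mpoly s)) !(rmorphXn (map_mpoly s)) /= !sX.
  by rewrite !(rmorphM (meval x)) !(rmorphXn (meval x)) /= !vX.
rewrite /= map_mpolyZ rmorph_nat [LHS]mevalZ; congr (_ * _).
rewrite (rmorphXn (map_mpoly s)) (rmorphXn (meval x)) /=; congr (_ ^+ _).
rewrite (rmorph_sum (map_mpoly s)) (rmorph_sum (meval x)); apply: eq_bigr => i _.
by rewrite (rmorphXn (map_mpoly s)) /= sX (rmorphXn (meval x)) /= vX.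
Qed.

Lemma digit_form_eval (z : 'I_(6 + m) -> K) : digit_form.@[z] = digit_form_fun z.
Proof.
rewrite -(map_digit_form (idfun : {rmorphism K -> K})); congr (_.@[_]).
by apply/mpolyP => k; rewrite mcoeff_map_mpoly.
Qed.

Lemma digit_form_mic : mic_form m digit_form.
Proof.
have hX j : ('X_j : {mpoly K[6 + m]}) \is 1.-homog.
  by rewrite dhomogX; apply/eqP; exact: mdeg1.
split.
  apply: dhomogD.
    apply: (big_ind (fun q => q \is m.-homog)) => [||i _].
    - exact: dhomog0.
    - by move=> ? ?; exact: dhomogD.
    have e : (1 + 1 * i + 1 * (m.-1 - i))%N = m by have := ltn_ord i; lia.
    rewrite -[X in X.-homog]e.
    by apply: dhomogM; [apply: dhomogM; [exact: hX | exact: dhomogMn] | exact: dhomogMn].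
  apply: dhomogZ; have e : (2 * m./2)%N = m by rewrite mul2n even_halfK.
  rewrite -[X in X.-homog]e; apply: dhomogMn.
  apply: (big_ind (fun q => q \is 2.-homog)) => [||i _].
  - exact: dhomog0.
  - by move=> ? ?; exact: dhomogD.
  - exact: (dhomogMn 2 (hX i)).
apply: integral_coefsD.
  apply: integral_coefs_sum => i _; repeat apply: integral_coefsM;
    by [exact: integral_coefsX | apply: integral_coefs_exp; exact: integral_coefsX].
apply: integral_coefsZ; first exact: in_OK_nat.
apply: integral_coefs_exp; apply: integral_coefs_sum => i _.
by apply: integral_coefs_exp; exact: integral_coefsX.
Qed.

(** The m monomials lose at most m S^(m/2), so at least one S^(m/2) of the second summand
    survives. *)
Lemma digit_form_pos : totally_positive_definite R digit_form.
Proof.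
move=> s x [j xj]; rewrite map_digit_form /digit_form_fun.
set S := \sum_j x j ^+ 2.
have hS i : x i ^+ 2 <= S.
  by rewrite /S (bigD1 i) //= lerDl sumr_ge0 // => k _; exact: sqr_ge0.
have S0 : 0 < S by apply: lt_le_trans (hS j); rewrite lt0r sqrf_eq0 xj sqr_ge0.
have : - (m%:R * S ^+ m./2) <=
    \sum_(i < m) x (rshift 6 i) * x (lshift m 1) ^+ i * x (lshift m 0) ^+ (m.-1 - i).
  rewrite -mulrN mulr_natl -[X in _ *+ X]card_ord -sumr_const.
  by apply: ler_sum => i _; apply: monomial_bound.
by have := exprn_gt0 m./2 S0; rewrite -[m.+1]addn1 natrD mulrDl mul1r; lra.
Qed.

(** The constant c is read off from (m+1) ((m+2) X^2)^(m/2) = c X^m. The squares of u, X and the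
    digits leave room for the y_i, since f 0 < X forces X >= 1. *)
Lemma digit_form_represents (c : nat := (m.+1 * m.+2 ^ m./2)%N) (X : nat) (f : nat -> nat) :
  (forall i, (f i < X)%N) ->
  represents digit_form (c * X ^ m + \sum_(i < m) f i * X ^ i)%N%:R.
Proof.
move=> fX.
have sum_le : (1 + X ^ 2 + \sum_(i < m) f i ^ 2 <= m.+2 * X ^ 2)%N.
  have : (\sum_(i < m) f i ^ 2 <= \sum_(i < m) X ^ 2)%N.
    by apply: leq_sum => i _; rewrite leq_exp2r // ltnW.
  rewrite sum_nat_const card_ord; have := fX 0%N; nia.
have [y1 [y2 [y3 [y4 ey]]]] :=
  lagrange_four_squares (m.+2 * X ^ 2 - (1 + X ^ 2 + \sum_(i < m) f i ^ 2)).
pose g (i : 'I_6) : int := tnth [tuple 1; X%:Z; y1; y2; y3; y4] i.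
pose z (i : 'I_(6 + m)) : int := match split i with inl j => g j | inr j => (f j)%:Z end.
have zl j : z (lshift m j) = g j by rewrite /z (unsplitK (inl j)).
have zr j : z (rshift 6 j) = (f j)%:Z by rewrite /z (unsplitK (inr j)).
exists (fun i => (z i)%:~R); split; first by move=> i; exact: in_OK_int.
rewrite digit_form_eval /digit_form_fun.
have -> : \sum_j (z j)%:~R ^+ 2 = (m.+2 * X ^ 2)%N%:R :> K.
  transitivity ((\sum_j z j ^+ 2)%:~R : K).
    by rewrite rmorph_sum /=; apply: eq_bigr => i _; rewrite rmorphXn.
  have -> // : \sum_j z j ^+ 2 = (m.+2 * X ^ 2)%N%:Z.
  rewrite big_split_ord /= (eq_bigr (fun j => g j ^+ 2)); last by move=> i _; rewrite zl.
  rewrite [X in _ + X](eq_bigr (fun i : 'I_m => (f i ^ 2)%N%:Z)); last first.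
    by move=> i _; rewrite zr; rewrite -[RHS]natz natrX natz.
  rewrite -(big_morph Posz PoszD erefl) !big_ord_recl big_ord0 /=.
  rewrite /g !(tnth_nth 0) /=; move: ey; rewrite -subzn // => ey.
  by rewrite addr0 -!addrA [y1 ^+ 2 + _]addrA [_ + (y3 ^+ 2 + _)]addrA; lra.
rewrite (eq_bigr (fun i : 'I_m => (f i * X ^ i)%N%:R)); last first.
  move=> i _; rewrite zr !zl /g !(tnth_nth 0) /= expr1n mulr1 natrM natrX.
  by rewrite -!pmulrn.
rewrite -natr_sum -natrX -natrM -natrD addnC expnMn -expnM mul2n even_halfK //.
by rewrite /c mulnA.
Qed.

Lemma form_representing_naturals :
  form_representing R m (fun a : K => exists n : nat, a = n%:R).
Proof.
pose c := (m.+1 * m.+2 ^ m./2)%N.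
have [|n0 large] := @power_plus_digits m c m_gt0; first by rewrite muln_gt0 expn_gt0.
(* Zero is included so that a small number can be written as 0 + n in the direct sum with
   [small]. *)
have fX : form_representing R m
    (fun a : K => exists2 n : nat, (n == 0%N) || (n0 <= n)%N & a = n%:R).
  exists (6 + m)%N, digit_form; split; [exact: digit_form_mic | exact: digit_form_pos |].
  have rX n : (n0 <= n)%N -> represents digit_form n%:R.
    by move=> /large [X [f [_ fX ->]]]; exact: digit_form_represents.
  move=> _ [n h ->]; case/orP: h => [/eqP ->|]; last exact: rX.
  have -> : (0%:R : K) = 0%:R ^+ m * n0%:R by rewrite expr0n gtn_eqF // mul0r.
  exact: represents_scale digit_form_mic (in_OK_nat K 0) (rX n0 (leqnn _)).
(* Each further summand v^m contributes 0 or 1. *)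
have small k : form_representing R m (fun a : K => exists2 n : nat, (n <= k)%N & a = n%:R).
  elim: k => [|k IH].
    apply: form_representing_mono (form_representing0 _ _ _) => a [n].
    by rewrite leqn0 => /eqP -> ->.
  have h := form_representingD m_gt0 IH (form_representing_pow R K m_even).
  apply: form_representing_mono h => _ [n nk ->].
  exists (n.-1)%:R, (n != 0)%N%:R; split.
  - by exists n.-1 => //; case: n nk.
  - exists (n != 0)%N%:R; first exact: in_OK_nat.
    by case: (n != 0)%N; rewrite ?expr1n // expr0n gtn_eqF.
  - by rewrite -natrD; congr (_%:R); case: n {nk} => //= n; rewrite addn1.
apply: form_representing_mono (form_representingD m_gt0 fX (small n0)) => _ [n ->].
case: (leqP n0 n) => n0n.
  exists n%:R, 0; split; rewrite ?addr0 //; last by exists 0%N.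
  by exists n; rewrite ?n0n ?orbT.
exists 0, n%:R; split; rewrite ?add0r //; first by exists 0%N.
by exists n; rewrite // ltnW.
Qed.

End UniversalForNaturals.

(** * Real embeddings *)

Section PrimitiveElement.
Variable K : fieldExtType rat.

Local Notation "f ^K" := (map_poly (in_alg K) f) (at level 2, format "f ^K").

Lemma rmorph_alg_rat (L : unitRingType) (s : {rmorphism K -> L}) (q : rat) :
  s q%:A = ratr q.
Proof. by rewrite alg_num_field fmorph_rat. Qed.

Lemma rmorph_eval_rat (L : fieldType) (s : {rmorphism K -> L}) (f : {poly rat}) (x : K) :
  s f^K.[x] = (map_poly ratr f).[s x].
Proof.
rewrite -horner_map -map_poly_comp; congr (_.[_]).
by apply: eq_map_poly => q /=; rewrite rmorph_alg_rat.
Qed.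

Lemma int_alg_rat (a : int) : a%:~R = (a%:~R : rat)%:A :> K.
Proof. by rewrite -[RHS]/(in_alg K _) rmorph_int. Qed.

Lemma int_eq0 (a : int) : (a%:~R == 0 :> K) = (a == 0).
Proof. by rewrite int_alg_rat -[_%:A]/(in_alg K _) fmorph_eq0 intr_eq0. Qed.

(** Clear denominators to get q over Z of degree n with leading coefficient b. Then b^(n-1) q(X/b)
    is monic and integral and has the root b x; it is the polynomial [g] below. *)
Lemma integral_multiple (f : {poly rat}) (x : K) : f != 0 -> root f^K x ->
  exists2 a : int, a != 0 & in_OK (a%:~R * x).
Proof.
have [q [a a0 ef]] := rat_poly_scale f; move=> f0 fx.
have q0 : q != 0 by apply: contraNneq f0 => q0; rewrite ef q0 map_poly0 scaler0.
have qx : (map_poly intr q : {poly K}).[x] = 0.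
  have -> : map_poly intr q = (a%:~R *: f)^K.
    rewrite ef scalerA mulfV ?intr_eq0 // scale1r -map_poly_comp.
    by apply: eq_map_poly => z /=; rewrite int_alg_rat.
  by rewrite map_polyZ hornerZ (rootP fx) mulr0.
pose b := lead_coef q; exists b; first by rewrite lead_coef_eq0.
have [n sq] : exists n, size q = n.+1 by exists (size q).-1; rewrite prednK // size_poly_gt0.
pose g : {poly int} := 'X^n + \poly_(i < n) (q`_i * b ^+ (n.-1 - i)).
exists g.
  by rewrite monicE lead_coefDl ?lead_coefXn // size_polyXn ltnS size_poly.
apply/rootP; rewrite rmorphD /= map_polyXn hornerD hornerXn.
have -> : (map_poly intr (\poly_(i < n) (q`_i * b ^+ (n.-1 - i))) : {poly K}).[b%:~R * x] =
    \sum_(i < n) (q`_i)%:~R * b%:~R ^+ n.-1 * x ^+ i.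
  rewrite poly_def rmorph_sum /= horner_sum; apply: eq_bigr => i _.
  rewrite map_polyZ /= map_polyXn hornerZ hornerXn rmorphM rmorphXn /= exprMn.
  have -> : (n.-1 = n.-1 - i + i)%N by have := ltn_ord i; lia.
  by rewrite exprD addnK; ring.
(* For n = 0, q would be a nonzero constant with a root. *)
case: n => [|n] in sq g *.
  exfalso; move: qx; rewrite horner_coef size_map_poly_id0; last first.
    by rewrite int_eq0 lead_coef_eq0.
  rewrite sq big_ord1 coef_map expr0 mulr1 /= => /eqP; rewrite int_eq0.
  by apply/negP; rewrite -[q`_0](_ : lead_coef q = _) ?lead_coef_eq0 // /lead_coef sq.
move: qx; rewrite horner_coef size_map_poly_id0 ?int_eq0 ?lead_coef_eq0 // sq big_ord_recr /=.
move/(congr1 (fun y => b%:~R ^+ n * y)); rewrite mulr0 mulrDr => qx; rewrite -[RHS]qx.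
rewrite addrC big_distrr /=; congr (_ + _).
  by apply: eq_bigr => i _; rewrite coef_map /=; ring.
by rewrite coef_map /= -[q`_n.+1](_ : b = _) ?exprMn ?exprS; [ring | rewrite /b /lead_coef sq].
Qed.

(** A separable generator exists in characteristic 0, and an integer multiple of it is integral and
    still generates K. The polynomial p is the minimal polynomial of [th]. *)
Lemma primitive_integer : exists (th : K) (p : {poly rat}),
  [/\ in_OK th, p \is monic, separable_poly p, (1 < size p)%N &
      (forall f : {poly rat}, p %| f <-> f^K.[th] = 0)
      /\ (forall x, exists f : {poly rat}, f^K.[th] = x)].
Proof.
have char0 : [pchar K] =i pred0 by move=> u; rewrite pchar_lalg pchar_num.
pose g : K := separable_generator 1%AS {:K}%AS.
have gen (x : K) : exists f : {poly rat}, f^K.[g] = x.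
  have : x \in <<1; g>>%VS.
    rewrite -eq_adjoin_separable_generator ?memvf ?subvf //.
    by apply/separableP => y _; exact: pcharf0_separable.
  by case/Fadjoin_polyP => _ /polyOver1P [f ->] ->; exists f.
have minP (y : K) : exists p : {poly rat}, [/\ p \is monic, separable_poly p, (1 < size p)%N &
    forall f : {poly rat}, p %| f <-> f^K.[y] = 0].
  have /polyOver1P [p ep] := minPolyOver 1%AS y.
  have sp : size p = size (minPoly 1%AS y) by rewrite ep size_map_poly.
  exists p; split.
  - by rewrite -(map_monic (in_alg K)) -ep monic_minPoly.
  - by rewrite -(separable_map (in_alg K)) -ep; exact: pcharf0_separable.
  - by rewrite sp size_minPoly ltnS.
  - move=> f; rewrite -(dvdp_map (in_alg K)) -ep; split.
      by move=> /dvdpP [h ->]; rewrite hornerM minPolyxx mulr0.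
    by move=> fy; apply: minPoly_dvdp; [apply/polyOver1P; exists f | apply/rootP].
have [p0 [p0_monic _ _ p0P]] := minP g.
have [|a a0 oa] := @integral_multiple p0 g (monic_neq0 p0_monic).
  by apply/rootP/p0P.
have [p [p_mon p_sep p_size pP]] := minP (a%:~R * g).
exists (a%:~R * g), p; split=> //; split=> // x.
have [f <-] := gen x; exists (f \Po ((a%:~R)^-1 *: 'X)).
rewrite map_comp_poly horner_comp map_polyZ map_polyX hornerZ hornerX.
congr (_.[_]); rewrite mulrA fmorphV /=.
by rewrite -int_alg_rat mulVf ?mul1r // int_eq0.
Qed.

(** K is the quotient of the rational polynomials by p: each x is written as a polynomial in [th],
    which is then evaluated at y. Two choices differ by a multiple of p, which vanishes at y. *)
Lemma number_field_emb (L : numFieldType) (th : K) (p : {poly rat}) (y : L) :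
  (forall f : {poly rat}, p %| f <-> f^K.[th] = 0) ->
  (forall x, exists f : {poly rat}, f^K.[th] = x) ->
  root (map_poly ratr p) y -> exists s : {rmorphism K -> L}, s th = y.
Proof.
move=> pP gen py; pose F x := sval (sig_eqW (gen x)).
have FE x : (F x)^K.[th] = x by rewrite /F; case: (sig_eqW _).
pose s x := (map_poly ratr (F x)).[y].
have sE f : s f^K.[th] = (map_poly ratr f).[y].
  apply/eqP; rewrite -subr_eq0 -hornerN -hornerD -rmorphB.
  have /dvdpP [g ->] : p %| F f^K.[th] - f.
    by apply/pP; rewrite rmorphB hornerD hornerN /= FE subrr.
  by rewrite rmorphM hornerM (rootP py) mulr0.
have sB : {morph s : x z / x - z}.
  move=> x z; rewrite -{1}(FE x) -{1}(FE z) -hornerN -hornerD -rmorphB sE.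
  by rewrite rmorphB hornerD hornerN.
have sM : GRing.monoid_morphism s.
  split=> [|x z].
    by have := sE 1; rewrite !rmorph1 !hornerC.
  by rewrite -{1}(FE x) -{1}(FE z) -hornerM -rmorphM sE rmorphM hornerM.
pose mB := GRing.isZmodMorphism.Build K L s sB.
pose mM := GRing.isMonoidMorphism.Build K L s sM.
pose sR : {rmorphism K -> L} := HB.pack s mB mM.
exists sR; have := sE 'X; rewrite !map_polyX !hornerX; exact.
Qed.

(** Each complex root of p yields an embedding into [R[i]]; total reality makes the root real, which
    gives an embedding into R. Conversely an embedding sends [th] to a root and is determined by
    it. *)
Lemma real_embeddings (R : realType) : totally_real R K ->
  exists (d : nat) (th : K) (s : 'I_d -> {rmorphism K -> R}),
  [/\ (0 < d)%N, in_OK th, injective (fun i => s i th),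
      forall x : K, exists q : 'I_d -> rat, x = \sum_j (q j)%:A * th ^+ j
    & forall t : {rmorphism K -> R}, exists i, t =1 s i].
Proof.
move=> real_K; have [th [p [oth p_mon p_sep p_size [pP gen]]]] := primitive_integer.
have [r er] := closed_field_poly_normal (map_poly ratr p : {poly R[i]}).
rewrite (monicP _) ?map_monic // scale1r in er.
have uniq_r : uniq r by rewrite -separable_prod_XsubC -er separable_map.
have size_r : size p = (size r).+1.
  by rewrite -(size_map_poly (ratr : rat -> R[i])) er size_prod_XsubC.
pose d := size r; have d0 : (0 < d)%N by rewrite -ltnS -size_r.
have rC (x : R) : root (map_poly ratr p) x = (x%:C%C \in r).
  rewrite -root_prod_XsubC -er -(fmorph_root (real_complex R)) -map_poly_comp.
  by congr (root _ _); apply: eq_map_poly => q /=; rewrite fmorph_rat.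
have emb (i : 'I_d) : exists s : {rmorphism K -> R}, (s th)%:C%C = r`_i.
  have [sC sCth] : exists s : {rmorphism K -> R[i]}, s th = r`_i.
    by apply: (number_field_emb pP gen); rewrite er root_prod_XsubC mem_nth.
  have ri : (complex.Re r`_i)%:C%C = r`_i.
    by rewrite -sCth; have := real_K sC th; case: (sC th) => a b /= ->.
  have [s sth] : exists s : {rmorphism K -> R}, s th = complex.Re r`_i.
    by apply: (number_field_emb pP gen); rewrite rC ri mem_nth.
  by exists s; rewrite sth.
have [s sE] := fin_all_exists emb.
exists d, th, s; split=> //.
- move=> i j /= e; apply: val_inj; apply/eqP.
  by rewrite -(nth_uniq 0 _ _ uniq_r) ?ltn_ord // -!sE e.
- move=> x; have [f <-] := gen x; exists (fun j => (f %% p)`_j).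
  have sf : (size (f %% p)%R <= d)%N.
    by rewrite -ltnS -size_r ltn_modp monic_neq0.
  rewrite {1}(divp_eq f p) rmorphD rmorphM hornerD hornerM /=.
  rewrite (iffLR (pP p)) ?dvdpp // mulr0 add0r.
  rewrite (horner_coef_wide _ (_ : (size _ <= d)%N)) ?size_map_poly //.
  by apply: eq_bigr => j _; rewrite coef_map.
- move=> t; have : root (map_poly ratr p) (t th).
    by apply/rootP; rewrite -rmorph_eval_rat (iffLR (pP p)) ?dvdpp ?rmorph0.
  rewrite rC => /(nthP 0) [i id ei]; exists (Ordinal id) => x.
  have [f <-] := gen x; rewrite !rmorph_eval_rat; congr (_.[_]).
  by apply: (fmorph_inj (real_complex R)); rewrite /= -ei (sE (Ordinal id)).
Qed.

End PrimitiveElement.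

(** * Units and balanced totally positive integers *)

(** Pigeonhole device: one element of P is kept for each value that the key attains on P. *)
Lemma finite_representatives (X : eqType) (T : finType) (P : X -> Prop) (key : X -> T) :
  exists l : seq X, (forall y, y \in l -> P y) /\
    forall x, P x -> exists2 y, y \in l & key y = key x.
Proof.
have ex (k : T) : exists o : option X,
    if o is Some y then P y /\ key y = k else forall x, P x -> key x <> k.
  case: (boolp.EM (exists2 y, P y & key y = k)) => [[y Py ky]|no]; first by exists (Some y).
  by exists None => x Px kx; apply: no; exists x.
have [f fE] := fin_all_exists ex; exists (pmap f (enum T)); split.
  by move=> y; rewrite mem_pmap => /mapP [k _ e]; have := fE k; rewrite -e => -[].
move=> x Px; have := fE (key x); case e: (f (key x)) => [y|] => [[Py ky]|/(_ x Px)] //.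
by exists y => //; rewrite mem_pmap -e map_f ?mem_enum.
Qed.

(** Z is integrally closed; the equation is carried over to [algC], where rational algebraic
    integers are known to be integers. *)
Lemma rational_integer (R : realType) (q : rat) :
  integralOver (intr : int -> R) (ratr q) -> exists z : int, q = z%:~R.
Proof.
move=> [p p_mon pq].
have {}pq : root (map_poly intr p : {poly rat}) q.
  rewrite -(fmorph_root (ratr : rat -> R)) -map_poly_comp.
  by rewrite (eq_map_poly (g := intr)) // => z /=; rewrite ratr_int.
have /Cint_rat_Aint : (ratr q : algC) \in Crat by exact: Crat_rat.
case/(_ _)/intrP => [|z ez].
  apply: (@root_monic_Aint (map_poly intr p)); last 2 first.
  - exact: monic_map.
  - by apply/polyOverP => i; rewrite coef_map /= rpred_int.
  have := pq; rewrite -(fmorph_root (ratr : rat -> algC)) -map_poly_comp.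
  by rewrite (eq_map_poly (g := intr)) // => z /=; rewrite ratr_int.
by exists z; apply: (fmorph_inj (ratr : rat -> algC)); rewrite /= ez ratr_int.
Qed.

Lemma nth_root_exists (R : rcfType) (n : nat) (x : R) : (0 < n)%N -> 0 < x ->
  exists2 y, 0 < y & y ^+ n = x.
Proof.
move=> n0 x0; have [||y /andP [y0 _]] := @poly_ivt R ('X^n - x%:P) 0 (x + 1).
- by rewrite addr_ge0 // ltW.
- rewrite !hornerE expr0n gtn_eqF // sub0r oppr_le0 (ltW x0) /= subr_ge0.
  apply: (@le_trans _ _ (x + 1)); first by rewrite lerDl.
  by rewrite ler_eXnr // lerDr ltW.
rewrite /root !hornerE subr_eq0 => /eqP e; exists y => //.
by rewrite lt_neqAle y0 andbT; apply: contraTneq x0 => yz; rewrite -e -yz expr0n gtn_eqF ?ltxx.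
Qed.

(** The coefficient depends on the value y and not on its position, so a repeated entry would count
    twice; hence [uniq] in [nat_span_mem]. *)
Definition nat_span (A : nzRingType) (l : seq A) (x : A) : Prop :=
  exists c : A -> nat, x = \sum_(y <- l) y * (c y)%:R.

Section NatSpan.
Variables (A : nzRingType) (l : seq A).

Lemma nat_span0 : nat_span l 0.
Proof. by exists (fun _ => 0%N); rewrite big1 // => y _; rewrite mulr0. Qed.

Lemma nat_spanD x y : nat_span l x -> nat_span l y -> nat_span l (x + y).
Proof.
move=> [c ->] [c' ->]; exists (fun z => c z + c' z)%N; rewrite -big_split.
by apply: eq_bigr => z _; rewrite natrD mulrDr.
Qed.

Lemma nat_spanMn x n : nat_span l x -> nat_span l (x *+ n).
Proof.
by move=> sx; elim: n => [|n IH]; [exact: nat_span0 | rewrite mulrS; exact: nat_spanD].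
Qed.

Lemma nat_span_mem x : uniq l -> x \in l -> nat_span l x.
Proof.
move=> l_uniq xl; exists (fun y => y == x); rewrite (bigD1_seq x) //= eqxx mulr1.
by rewrite big1 ?addr0 // => y /negbTE ->; rewrite mulr0.
Qed.

Lemma nat_span_sum (I : Type) (r : seq I) (F : I -> A) :
  (forall i, nat_span l (F i)) -> nat_span l (\sum_(i <- r) F i).
Proof.
by move=> sF; apply: big_ind => //; [exact: nat_span0 | exact: nat_spanD].
Qed.

End NatSpan.

(** * Traces, norms, small integers and units *)

Section Arithmetic.
Variables (R : realType) (K : fieldExtType rat) (d : nat) (th : K).
Variable s : 'I_d -> {rmorphism K -> R}.
Hypotheses (d_gt0 : (0 < d)%N) (th_int : in_OK th).
Hypothesis s_inj : injective (fun i => s i th).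
Hypothesis span : forall x : K, exists q : 'I_d -> rat,
  x = \sum_j (q j)%:A * th ^+ j.
Implicit Types x y : K.

(** Row j lists the conjugates of th^j. Invertibility of V yields rational traces and norms,
    nondegeneracy of the trace and independence of the powers of [th]. *)
Let V : 'M[R]_d := Vandermonde d (\row_i s i th).

Let V_unit : V \in unitmx.
Proof.
rewrite unitmxE unitfE det_Vandermonde; apply/prodf_neq0 => i _.
apply/prodf_neq0 => j ij; rewrite !mxE subr_eq0; apply/eqP => /s_inj e.
by rewrite e ltnn in ij.
Qed.

Let mul_mx_diag_embeddings x : exists A : 'M[rat]_d,
  V *m diag_mx (\row_i s i x) = map_mx ratr A *m V.
Proof.
have [q qE] := fin_all_exists (fun j : 'I_d => span (x * th ^+ j)).
exists (\matrix_(j, k) q j k); apply/matrixP => j i.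
rewrite mul_mx_diag !mxE -rmorphXn mulrC -rmorphM qE rmorph_sum.
by apply: eq_bigr => k _; rewrite !mxE rmorphM rmorph_alg_rat rmorphXn.
Qed.

(* Multiplication by x has a rational matrix in the powers of th; the Vandermonde
   matrix conjugates it to the diagonal matrix of the conjugates of x. *)
Lemma trace_rational x : exists q : rat, \sum_i s i x = ratr q.
Proof.
have [A eA] := mul_mx_diag_embeddings x; exists (\tr A).
rewrite -trace_map_mx.
have -> : map_mx ratr A = V *m diag_mx (\row_i s i x) *m invmx V :> 'M[R]_d.
  by rewrite eA mulmxK.
rewrite mxtrace_mulC mulmxA mulVmx // mul1mx /mxtrace.
by apply: eq_bigr => i _; rewrite !mxE eqxx.
Qed.

Lemma norm_rational x : exists q : rat, \prod_i s i x = ratr q.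
Proof.
have [A eA] := mul_mx_diag_embeddings x; exists (\det A).
rewrite -det_map_mx; have := congr1 determinant eA; rewrite !det_mulmx mulrC.
move/(mulIf _) <-; last by rewrite -unitfE -unitmxE.
by rewrite det_diag; apply: eq_bigr => i _; rewrite mxE.
Qed.

Lemma embedding_integral i x : in_OK x <-> integralOver (intr : int -> R) (s i x).
Proof.
have e (p : {poly int}) : root (map_poly intr p) (s i x) = root (map_poly intr p) x.
  rewrite -(fmorph_root (s i)) -map_poly_comp; congr (root _ _).
  by apply: eq_map_poly => z /=; rewrite rmorph_int.
by split=> [] [p p_mon px]; exists p => //; move: px; rewrite e.
Qed.

Lemma trace_integer x : in_OK x -> exists z : int, \sum_i s i x = z%:~R.
Proof.
move=> ox; have [q eq] := trace_rational x.
have [|z ez] := @rational_integer R q; last by exists z; rewrite eq ez ratr_int.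
rewrite -eq; apply: (big_ind (integralOver (intr : int -> R))) => [||i _].
- exact: integral0.
- exact: integral_add.
- exact/embedding_integral.
Qed.

(** A partial product of conjugates need not come from K, so its integrality is stated in R. *)
Let prod_integral (P : pred 'I_d) x : in_OK x ->
  integralOver (intr : int -> R) (\prod_(i | P i) s i x).
Proof.
move=> ox; apply: (big_ind (integralOver (intr : int -> R))) => [||i _].
- exact: integral1.
- exact: integral_mul.
- exact/embedding_integral.
Qed.

Lemma norm_integer x : in_OK x -> exists z : int, \prod_i s i x = z%:~R.
Proof.
move=> ox; have [q eq] := norm_rational x.
have [|z ez] := @rational_integer R q; last by exists z; rewrite eq ez ratr_int.
by rewrite -eq; exact: prod_integral.
Qed.

Lemma norm_neq0 x : x != 0 -> \prod_i s i x != 0.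
Proof. by move=> x0; apply/prodf_neq0 => i _; rewrite fmorph_eq0. Qed.

Lemma norm_ge1 x : in_OK x -> x != 0 -> 1 <= \prod_i `|s i x|.
Proof.
move=> ox x0; have [z ez] := norm_integer ox; rewrite -normr_prod ez.
have : (z%:~R : R) != 0 by rewrite -ez norm_neq0.
by rewrite intr_eq0 -intr_norm -[1]/(1%:~R) ler_int; lia.
Qed.

(** One embedding sends the quotient to the product of the other conjugates of x. *)
Lemma norm_quotient_integral x (z : int) : in_OK x -> x != 0 ->
  \prod_i s i x = z%:~R -> in_OK (z%:~R / x).
Proof.
move=> ox x0 ez; apply/(embedding_integral (Ordinal d_gt0)).
rewrite rmorphM fmorphV rmorph_int -ez (bigD1 (Ordinal d_gt0)) //=.
by rewrite [s _ x * _]mulrC mulfK ?fmorph_eq0 //; exact: prod_integral.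
Qed.

(** These traces are the entries of V times the vector of conjugates of x. *)
Lemma traces_separate x : (forall j : 'I_d, \sum_i s i (x * th ^+ j) = 0) -> x = 0.
Proof.
move=> tr0; have : V *m (\col_i s i x) = 0.
  apply/colP => j; rewrite !mxE -[RHS](tr0 j); apply: eq_bigr => i _.
  by rewrite !mxE rmorphM rmorphXn mulrC.
move/(congr1 (mulmx (invmx V))); rewrite mulKmx // mulmx0 => /colP /(_ (Ordinal d_gt0)).
by rewrite !mxE => /eqP; rewrite fmorph_eq0 => /eqP.
Qed.

Lemma powers_free (b : 'I_d -> int) : \sum_j (b j)%:~R * th ^+ j = 0 -> forall j, b j = 0.
Proof.
move=> b0 j; have : (\row_j (b j)%:~R) *m V = 0.
  apply/rowP => i; rewrite !mxE -[RHS](rmorph0 (s i)) -b0 rmorph_sum.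
  by apply: eq_bigr => k _; rewrite !mxE rmorphM rmorph_int rmorphXn.
move/(congr1 (mulmx^~ (invmx V))); rewrite mulmxK // mul0mx => /rowP /(_ j).
by rewrite !mxE => /eqP; rewrite intr_eq0 => /eqP.
Qed.

(* Such an x is determined by the bounded integers Tr(x th^j). *)
Lemma finite_bounded_integers (B : R) : exists l : seq K,
  forall x, in_OK x -> (forall i, `|s i x| <= B) -> x \in l.
Proof.
pose A (j : 'I_d) := \sum_i B * `|s i th| ^+ j.
pose N := (Num.truncn (\sum_j `|A j|)).+1.
pose P x := in_OK x /\ forall i, `|s i x| <= B.
(* The traces are integers in [-N, N]; shifted by N they become naturals at most 2N. *)
pose key x : {ffun 'I_d -> 'I_(2 * N).+1} :=
  [ffun j : 'I_d => inord (Num.truncn (\sum_i s i (x * th ^+ j) + N%:R))].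
have keyE x (j : 'I_d) : P x -> \sum_i s i (x * th ^+ j) = (key x j)%:R - N%:R.
  move=> [ox bx]; have [z ez] : exists z : int, \sum_i s i (x * th ^+ j) = z%:~R.
    by apply: trace_integer; apply: in_OKM => //; exact: in_OKX.
  have zN : `|z%:~R| <= N%:R :> R.
    rewrite -ez (le_trans (ler_norm_sum _ _ _)) // (@le_trans _ _ (A j)) //.
      apply: ler_sum => i _; rewrite rmorphM rmorphXn normrM normrX.
      by apply: ler_wpM2r; [exact: exprn_ge0 | exact: bx].
    apply: le_trans (ler_norm _) _; apply: (@le_trans _ _ (\sum_j `|A j|)).
      by rewrite (bigD1 j) //= lerDl sumr_ge0.
    exact/ltW/truncnS_gt.
  rewrite ez ffunE; move: zN; rewrite -intr_norm -[N%:R]/(N%:Z%:~R) ler_int => zN.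
  have [k ek] : exists k : nat, z + N%:Z = k%:Z by exists (absz (z + N%:Z)); lia.
  have -> : \sum_i s i (x * th ^+ j) + N%:Z%:~R = k%:R.
    by rewrite ez -rmorphD /= ek.
  rewrite natrK inordK; last by lia.
  by rewrite -[k%:R]/(k%:Z%:~R) -ek rmorphD /= addrK.
have [l [lP lkey]] := finite_representatives P key.
exists l => x ox bx; have [|y yl ky] := lkey x; first by split.
suff -> : x = y by [].
apply/eqP; rewrite -subr_eq0; apply/eqP/traces_separate => j.
have -> : \sum_i s i ((x - y) * th ^+ j) =
    \sum_i s i (x * th ^+ j) - \sum_i s i (y * th ^+ j).
  by rewrite -sumrB; apply: eq_bigr => i _; rewrite mulrBl rmorphB.
by rewrite !keyE ?ky ?subrr //; exact: lP.
Qed.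

(* Minkowski's theorem for boxes, by pigeonhole on the combinations of the powers
   of th with coefficients in [0, H). *)
Lemma small_integer : exists2 C : R, 0 < C &
  forall t : 'I_d -> R, (forall i, 0 < t i) -> \prod_i t i = 1 ->
  exists b : {ffun 'I_d -> int}, \sum_j (b j)%:~R * th ^+ j != 0 /\
    forall i, `|s i (\sum_j (b j)%:~R * th ^+ j)| <= C * t i.
Proof.
pose W : R := 1 + \sum_i \sum_(j < d) `|s i th| ^+ j.
have Wi i : \sum_(j < d) `|s i th| ^+ j <= W.
  rewrite /W [X in 1 + X](bigD1 i) //= addrCA lerDl addr_ge0 // sumr_ge0 // => k _.
  by rewrite sumr_ge0 // => j _; exact: exprn_ge0.
have W0 : 0 < W.
  rewrite ltr_pwDl // sumr_ge0 // => k _; rewrite sumr_ge0 // => j _.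
  exact: exprn_ge0.
exists (8%:R * W); first by rewrite mulr_gt0.
move=> t t_gt0 prod_t.
(* H >= 4 t_i gives H / (4 t_i) >= 1, so rounding up to [B i] costs at most a factor 2. *)
pose H := (Num.truncn (\sum_i 4%:R * t i)).+1.
have H_gt0 : 0 < H%:R :> R by rewrite ltr0n.
have Ht i : 4%:R * t i <= H%:R.
  apply: le_trans (ltW (truncnS_gt _)); rewrite (bigD1 i) //= lerDl sumr_ge0 // => k _.
  by rewrite mulr_ge0 // ltW.
pose x (a : {ffun 'I_d -> 'I_H}) : K := \sum_j (a j)%:R * th ^+ j.
have x_bound a i : `|s i (x a)| <= H%:R * W.
  rewrite /x rmorph_sum (le_trans (ler_norm_sum _ _ _)) //.
  apply: (@le_trans _ _ (\sum_(j < d) H%:R * `|s i th| ^+ j)).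
    apply: ler_sum => j _; rewrite rmorphM rmorph_nat rmorphXn normrM normrX normr_nat.
    by rewrite ler_wpM2r ?exprn_ge0 // ler_nat ltnW.
  by rewrite -mulr_sumr ler_wpM2l // ltW.
(* The interval [-H W, H W] of the i-th conjugate is cut into cells of length 8 W t_i; [u] is the
   position measured in cells. *)
pose u a i := (s i (x a) + H%:R * W) / (8%:R * W * t i).
have u_den i : 0 < 8%:R * W * t i by rewrite !mulr_gt0.
have u_ge0 a i : 0 <= u a i.
  apply: divr_ge0; last exact/ltW.
  by have := x_bound a i; rewrite ler_norml => /andP [h _]; rewrite -lerBlDr sub0r.
pose B i := (Num.truncn (H%:R / (4%:R * t i))).+1.
have u_le a i : u a i <= H%:R / (4%:R * t i).
  rewrite /u ler_pdivrMr //.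
  have -> : H%:R / (4%:R * t i) * (8%:R * W * t i) = H%:R * W + H%:R * W.
    by field; rewrite gt_eqF.
  by rewrite lerD2r; apply: le_trans (x_bound a i); exact: ler_norm.
have cell_lt a i : (Num.truncn (u a i) < B i)%N by rewrite ltnS le_truncn.
pose cell a : {dffun forall i, 'I_(B i)} := [ffun i => Ordinal (cell_lt a i)].
have B_le i : (B i)%:R <= H%:R / (2%:R * t i).
  have -> : (B i)%:R = (Num.truncn (H%:R / (4%:R * t i)))%:R + 1 :> R by rewrite natr1.
  have h : 1 <= H%:R / (4%:R * t i).
    by rewrite ler_pdivlMr ?mul1r // mulr_gt0.
  have h2 : (Num.truncn (H%:R / (4%:R * t i)))%:R <= H%:R / (4%:R * t i).
    by rewrite truncn_le; apply: le_trans h.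
  have -> : H%:R / (2%:R * t i) = H%:R / (4%:R * t i) + H%:R / (4%:R * t i).
    by field; rewrite gt_eqF.
  exact: lerD h2 h.
(* As the t_i have product 1, there are at most (H/2)^d cells for H^d combinations. *)
have few_cells : (#|{dffun forall i, 'I_(B i)}| < #|{ffun 'I_d -> 'I_H}|)%N.
  rewrite card_dep_ffun foldrE big_image /=.
  rewrite card_ffun !card_ord -(ltr_nat R) natr_prod natrX.
  apply: (@le_lt_trans _ _ (\prod_(i < d) (H%:R / (2%:R * t i)))).
    by apply: ler_prod => i _; rewrite card_ord ler0n B_le.
  rewrite prodf_div big_split /= prod_t mulr1 !prodr_const card_ord.
  rewrite ltr_pdivrMr ?exprn_gt0 // ltr_pMr ?exprn_gt0 //.
  by rewrite exprn_egt1 ?ltr1n // -lt0n.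
have /injectivePn [a [a' aa' eq_cell]] : ~~ injectiveb cell.
  by apply: contraL few_cells => /injectiveP /leq_card; rewrite -leqNgt.
(* The coefficients are returned, since the construction of units reduces them modulo M. *)
exists [ffun j => (a j)%:Z - (a' j)%:Z].
have -> : \sum_j ([ffun j => (a j)%:Z - (a' j)%:Z] j)%:~R * th ^+ j = x a - x a'.
  by rewrite /x -sumrB; apply: eq_bigr => j _; rewrite ffunE rmorphB mulrBl.
split.
  apply: contra_neq aa' => xx; apply/ffunP => j; apply: val_inj => /=.
  have := @powers_free (fun j => (a j)%:Z - (a' j)%:Z) _ j.
  suff h : \sum_j ((a j)%:Z - (a' j)%:Z)%:~R * th ^+ j = 0.
    by move/(_ h)/eqP; rewrite subr_eq0 => /eqP [].
  by rewrite -[RHS]xx /x -sumrB; apply: eq_bigr => k _; rewrite rmorphB mulrBl.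
move=> i; have : Num.truncn (u a i) = Num.truncn (u a' i).
  by have := congr1 (fun f : {dffun forall i, 'I_(B i)} => val (f i)) eq_cell; rewrite !ffunE.
have /andP [l1 l2] := truncn_itv (u_ge0 a i).
have /andP [l3 l4] := truncn_itv (u_ge0 a' i).
move=> eq_t; rewrite eq_t in l1 l2; rewrite -natr1 in l2 l4.
have e : s i (x a - x a') = (u a i - u a' i) * (8%:R * W * t i).
  rewrite /u rmorphB; field; rewrite !gt_eqF //.
rewrite e normrM [`|8%:R * W * t i|]gtr0_norm // ler_piMl ?(ltW (u_den i)) //.
by rewrite ler_norml; apply/andP; split; lra.
Qed.

(* The quotient of two integers congruent modulo a common multiple of their norms
   is a unit, so the integers of small_integer fall into finitely many classes
   up to units. *)
Lemma unit_approximation : exists2 C : R, 0 < C &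
  forall t : 'I_d -> R, (forall i, 0 < t i) -> \prod_i t i = 1 ->
  exists e : K, [/\ e != 0, in_OK e, in_OK e^-1 & forall i, `|s i e| <= C * t i].
Proof.
have [C C_gt0 small] := small_integer.
pose x (b : {ffun 'I_d -> int}) : K := \sum_j (b j)%:~R * th ^+ j.
have x_int b : in_OK (x b).
  by apply: in_OK_sum => j _; apply: in_OKM; [exact: in_OK_int | exact: in_OKX].
pose N := (Num.truncn (C ^+ d)).+1.
(* N bounds the norms of the small integers, so each of these nonzero norms divides N!. *)
pose M := N`!.
have M_gt0 : (0 < M)%N := fact_gt0 _.
pose P b := x b != 0 /\ `|\prod_i s i (x b)| <= N%:R.
pose key (b : {ffun 'I_d -> int}) : {ffun 'I_d -> 'I_M.+1} :=
  [ffun j => inord (absz (b j %% M)%Z)].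
have quotient b b' : P b' -> key b = key b' -> in_OK (x b / x b').
  move=> [x0 xN] e_key; have [z ez] := norm_integer (x_int b').
  have z0 : z != 0 by rewrite -(intr_eq0 R) -ez norm_neq0.
  have [c ec] : exists c : int, M%:Z = c * z.
    move: xN; rewrite ez -intr_norm -[N%:R]/(N%:Z%:~R) ler_int => zN.
    have /dvdnP [c ec] : (absz z %| M)%N by apply: dvdn_fact; lia.
    have [zw|zw] : z = absz z \/ z = - (absz z)%:Z by lia.
      by exists c%:Z; rewrite zw ec PoszM.
    by exists (- c%:Z); rewrite zw mulrNN ec PoszM.
  pose q : {ffun 'I_d -> int} := [ffun j => (b j %/ M)%Z - (b' j %/ M)%Z].
  have ->: x b = x b' + M%:R * x q.
    rewrite /x mulr_sumr -big_split; apply: eq_bigr => j _ /=.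
    rewrite mulrA -mulrDl; congr (_ * _); rewrite -[M%:R]/(M%:Z%:~R) -rmorphM -rmorphD /=.
    congr (_%:~R); rewrite ffunE.
    have := congr1 (fun f : {ffun 'I_d -> 'I_M.+1} => f j : nat) e_key.
    have m1 := modz_ge0 (b j) (_ : M%:Z != 0); have m2 := modz_ge0 (b' j) (_ : M%:Z != 0).
    have m3 := ltz_pmod (b j) (_ : 0 < M%:Z); have m4 := ltz_pmod (b' j) (_ : 0 < M%:Z).
    rewrite /key /= !ffunE !inordK; [|lia|lia] => em.
    have {1}-> := divz_eq (b j) M; have {1}-> := divz_eq (b' j) M; lia.
  (* With M = c z, the quotient is 1 + c (z / x b') x q, where z / x b' is integral because z is the
     norm of x b'. *)
  rewrite mulrDl divff // mulrAC; apply: in_OKD; first exact: (in_OK_nat _ 1).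
  apply: in_OKM => //; rewrite -[M%:R]/(M%:Z%:~R) ec rmorphM -mulrA.
  by apply: in_OKM; [exact: in_OK_int | exact: norm_quotient_integral].
have [l [lP lkey]] := finite_representatives P key.
(* D bounds the inverses of all conjugates of the finitely many representatives. *)
pose D : R := 1 + \sum_(b <- l) \sum_i `|s i (x b)|^-1.
have inv_ge0 b : 0 <= \sum_i `|s i (x b)|^-1.
  by apply: sumr_ge0 => i _; rewrite invr_ge0.
have D_gt0 : 0 < D by rewrite ltr_pwDl // sumr_ge0.
have D_ge b i : b \in l -> `|s i (x b)|^-1 <= D.
  move=> bl; apply: (@le_trans _ _ (\sum_i `|s i (x b)|^-1)).
    by rewrite (bigD1 i) //= lerDl sumr_ge0 // => j _; rewrite invr_ge0.
  by rewrite /D (big_rem b bl) /= addrCA lerDl addr_ge0 // sumr_ge0.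
exists (C * D); first exact: mulr_gt0.
move=> t t_gt0 prod_t; have [b [xb b_le]] := small t t_gt0 prod_t.
have Pb : P b.
  split=> //; rewrite normr_prod; apply: (@le_trans _ _ (C ^+ d)); last exact/ltW/truncnS_gt.
  apply: (@le_trans _ _ (\prod_i (C * t i))).
    by apply: ler_prod => i _; rewrite normr_ge0 b_le.
  by rewrite big_split /= prod_t mulr1 prodr_const card_ord.
have [b' b'l kb] := lkey b Pb; have [xb' _] := lP _ b'l.
exists (x b / x b'); split.
- by rewrite mulf_neq0 // invr_eq0.
- by apply: quotient; [exact: lP | rewrite kb].
- by rewrite invf_div; apply: quotient.
- move=> i; rewrite fmorph_div normrM normfV mulrAC.
  by apply: ler_pM (normr_ge0 _) _ (b_le i) (D_ge _ i b'l); rewrite invr_ge0.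
Qed.

(** Let r_i be the m-th roots of the conjugates of a and w their geometric mean. A unit e with
    conjugates comparable to r_i / w leaves g = e^(-m) a with conjugates comparable to S = w^m. *)
Lemma balance (m : nat) : (0 < m)%N -> ~~ odd m -> exists L U : R, [/\ 0 < L, 0 < U &
  forall a, in_OK a -> (forall i, 0 < s i a) -> exists (e g : K) (S : R),
  [/\ in_OK e, in_OK g, a = e ^+ m * g, 0 < S & forall i, L * S <= s i g <= U * S]].
Proof.
move=> m0 ev; have [C C_gt0 units] := unit_approximation.
exists (C^-1 ^+ m), ((C ^+ d.-1) ^+ m); split; rewrite ?exprn_gt0 ?invr_gt0 //.
move=> a oa a_gt0.
have [r r_gt0 rE] := fin_all_exists2 (fun i => nth_root_exists m0 (a_gt0 i)).
have [w w_gt0 wE] : exists2 w : R, 0 < w & w ^+ d = \prod_i r i.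
  by apply: nth_root_exists => //; apply: prodr_gt0 => i _.
have t_gt0 i : 0 < r i / w by rewrite divr_gt0.
have prod_t : \prod_i (r i / w) = 1.
  by rewrite prodf_div prodr_const card_ord wE divff // gt_eqF // prodr_gt0.
have [e [e0 oe oe' e_le]] := units _ t_gt0 prod_t.
have se_gt0 i : 0 < `|s i e| by rewrite normr_gt0 fmorph_eq0.
(* The norm of e is at least 1 in absolute value, so upper bounds on the other conjugates bound this
   one from below. *)
have e_ge i : r i / w <= C ^+ d.-1 * `|s i e|.
  have h : \prod_(j | j != i) `|s j e| <= \prod_(j | j != i) (C * (r j / w)).
    by apply: ler_prod => j _; rewrite normr_ge0 e_le.
  rewrite big_split /= prodr_const cardC1 card_ord in h.
  have h1 := norm_ge1 oe e0; rewrite (bigD1 i) //= in h1.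
  rewrite (bigD1 i) //= in prod_t.
  apply: (@le_trans _ _ (r i / w * (`|s i e| * \prod_(j | j != i) `|s j e|))).
    by rewrite ler_peMr // ltW.
  apply: (@le_trans _ _ (r i / w * (`|s i e| *
      (C ^+ d.-1 * \prod_(j | j != i) (r j / w))))).
    by rewrite !ler_wpM2l // ltW.
  by rewrite mulrCA [r i / w * _]mulrCA prod_t mulr1 mulrC.
exists e, (e^-1 ^+ m * a), (w ^+ m); split=> //.
- by apply: in_OKM => //; exact: in_OKX.
- by rewrite mulrA -exprMn divff // expr1n mul1r.
- exact: exprn_gt0.
move=> i.
have -> : s i (e^-1 ^+ m * a) = (r i / `|s i e|) ^+ m.
  rewrite rmorphM rmorphXn fmorphV -rE exprMn exprVn [r i ^+ m * _]mulrC; congr (_ * _).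
  by rewrite exprVn -(normr_idP (_ : 0 <= s i e ^+ m)) ?normrX // exprn_even_ge0.
rewrite -!exprMn; apply/andP; split; rewrite lerXn2r ?nnegrE //.
- by rewrite mulr_ge0 ?invr_ge0 // ltW.
- by rewrite divr_ge0 // ltW.
- rewrite ler_pdivlMr //; apply: (@le_trans _ _ (C^-1 * w * (C * (r i / w)))).
    by rewrite ler_wpM2l // mulr_ge0 ?invr_ge0 // ltW.
  by have -> : C^-1 * w * (C * (r i / w)) = r i by field; rewrite !gt_eqF.
- by rewrite divr_ge0 // ltW.
- by rewrite mulr_ge0 ?exprn_ge0 // ltW.
- by rewrite ler_pdivrMr // mulrAC -ler_pdivrMr // e_ge.
Qed.

(** * Balanced elements as sums from a finite set *)

Let tot_pos x := forall i, 0 < s i x.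

(** Adding a large integer T makes the powers of [th] totally positive; the extra element 1 undoes
    the shift. *)
Lemma positive_spanning_family : exists (n : nat) (w : 'I_n -> K),
  (forall k, in_OK (w k) /\ tot_pos (w k)) /\
  forall x, exists q : 'I_n -> rat, x = \sum_k (q k)%:A * w k.
Proof.
pose T := (Num.truncn (\sum_i \sum_(j < d) `|s i th ^+ j|)).+1.
pose w (k : 'I_d.+1) : K := if unlift ord0 k is Some j then th ^+ j + T%:R else 1.
exists d.+1, w; split.
  move=> k; rewrite /w; case: unliftP => [j _|_]; split.
  - by apply: in_OKD; [exact: in_OKX | exact: in_OK_nat].
  - move=> i; rewrite rmorphD rmorph_nat rmorphXn.
    rewrite -ltrBlDl sub0r; apply: le_lt_trans (truncnS_gt _).
    apply: (@le_trans _ _ (\sum_(j < d) `|s i th ^+ j|)).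
      rewrite (bigD1 j) //= (le_trans (ler_norm _)) // normrN lerDl.
      by rewrite sumr_ge0.
    by rewrite [leRHS](bigD1 i) //= lerDl sumr_ge0 // => k' _; rewrite sumr_ge0.
  - exact: (in_OK_nat _ 1).
  - by move=> i; rewrite rmorph1.
move=> x; have [q ->] := span x.
exists (fun k => if unlift ord0 k is Some j then q j else - (\sum_j q j) * T%:R).
rewrite big_ord_recl /w unlift_none mulr1.
under [X in _ = _ + X]eq_bigr => j _ do rewrite liftK mulrDr.
rewrite big_split /= addrCA -[LHS]addr0; congr (_ + _).
rewrite -mulr_suml -[_%:A]/(in_alg K _) rmorphM rmorphN rmorph_nat rmorph_sum /=.
by rewrite mulNr addNr.
Qed.

(* With g = sum_k q_k w_k and c a suitable multiple of the size of g, divide the q_k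
   by c: g = c x + sum_k f_k w_k + y, where x collects the quotients, f_k are the
   integral parts of the remainders and y collects their fractional parts. Both
   x and y are bounded, and x is totally positive because c x stays within c W
   of g. *)
Lemma balanced_decomposition (L U : R) : 0 < L -> 0 < U -> exists l : seq K,
  (forall x, x \in l -> in_OK x /\ tot_pos x) /\
  forall g (S : R), in_OK g -> 0 < S -> (forall i, L * S <= s i g <= U * S) ->
  nat_span l g.
Proof.
move=> L0 U0; have [n [w [w_pos w_span]]] := positive_spanning_family.
have w0 k i : 0 < s i (w k) by have [_] := w_pos k; apply.
pose W := \sum_i \sum_k s i (w k).
have W_ge i : \sum_k s i (w k) <= W.
  rewrite /W [leRHS](bigD1 i) //= lerDl sumr_ge0 // => j _.
  by rewrite sumr_ge0 // => k _; exact/ltW.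
have W0 : 0 <= W by apply: sumr_ge0 => i _; apply: sumr_ge0 => k _; exact/ltW.
(* From L S0 = W + 1 follows s_i g >= c (W + 1), which exceeds the error c W and makes x totally
   positive. *)
pose S0 := (W + 1) / L.
have S0_gt0 : 0 < S0 by rewrite divr_gt0 // ltr_wpDl.
have LS0 : L * S0 = W + 1 by rewrite /S0; field; rewrite gt_eqF.
(* W bounds the w_k and y, and 2 U S0 bounds x, since S <= 2 c S0 for c >= 1. *)
pose B := W + 2%:R * U * S0.
have WB : W <= B by have := mulr_gt0 U0 S0_gt0; rewrite /B -mulrA; lra.
have [l0 l0P] := finite_bounded_integers B.
pose l := [seq x <- undup l0 | boolp.asbool (in_OK x /\ tot_pos x)].
have lE x : in_OK x -> tot_pos x -> (forall i, s i x <= B) -> nat_span l x.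
  move=> ox px bx; apply: nat_span_mem; first by rewrite filter_uniq ?undup_uniq.
  rewrite mem_filter mem_undup l0P ?andbT //; first exact/boolp.asboolP.
  by move=> i; rewrite gtr0_norm.
exists l; split; first by move=> x; rewrite mem_filter => /andP [/boolp.asboolP].
move=> g S og Sgt0 gS; have gpos i : 0 < s i g.
  by have /andP [h _] := gS i; apply: lt_le_trans h; rewrite mulr_gt0.
pose c := Num.truncn (S / S0).
have /andP [c_le c_gt] := truncn_itv (ltW (divr_gt0 Sgt0 S0_gt0)).
rewrite -/c in c_le c_gt.
(* For c = 0 we have S < S0, so g itself is bounded and belongs to the list. *)
have [c0|c_neq0] := eqVneq c 0%N.
  apply: lE => // i; have /andP [_ h] := gS i; apply: le_trans h _.
  rewrite c0 ltr_pdivrMr // mul1r in c_gt.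
  have h1 : U * S <= U * S0 by rewrite ler_wpM2l // ltW.
  have h2 : 0 <= U * S0 by rewrite mulr_ge0 // ltW.
  by rewrite /B -mulrA; lra.
have c1 : 1 <= c%:R :> R by rewrite ler1n lt0n.
have c1Q : 0 < c%:R :> rat by rewrite ltr0n lt0n.
have c_gt0 : 0 < c%:R :> R by apply: lt_le_trans c1.
have cS : c%:R * S0 <= S by rewrite -ler_pdivlMr.
have Sc : S <= 2%:R * c%:R * S0.
  rewrite -natr1 ltr_pdivrMr // in c_gt; apply: (le_trans (ltW c_gt)).
  by rewrite ler_wpM2r ?(ltW S0_gt0) //; lra.
have [q eq] := w_span g.
pose e k := Num.floor (q k / c%:R); pose r k := q k - c%:R * (e k)%:~R.
have r_ge0 k : 0 <= r k.
  by rewrite /r subr_ge0 mulrC -ler_pdivlMr // ge_floor.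
have r_lt k : r k < c%:R.
  have := floorD1_gt (q k / c%:R).
  by rewrite ltr_pdivrMr // intrD mulrDl mul1r -/(e k) /r mulrC; lra.
pose f k := Num.truncn (r k); pose h k := r k - (f k)%:R.
have /(_ _) /andP h_bnd k : 0 <= h k < 1.
  have /andP [h1 h2] := truncn_itv (r_ge0 k).
  by rewrite /h /f subr_ge0 h1 ltrBlDl natr1.
pose x := \sum_k (e k)%:~R * w k; pose y := \sum_k (h k)%:A * w k.
have gE : g = x *+ c + \sum_k w k *+ f k + y.
  rewrite eq /x /y -sumrMnl -!big_split; apply: eq_bigr => k _ /=.
  have {1}-> : q k = (e k)%:~R *+ c + (f k)%:R + h k by rewrite /h /r -mulr_natl; ring.
  rewrite !scalerDl -scalerMnl -int_alg_rat !mulrDl mulrnAl; congr (_ + _ + _).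
    exact: mulrnAl.
  by rewrite scaler_nat mulr_natl.
have ox : in_OK x.
  by apply: in_OK_sum => k _; apply: in_OKM; [exact: in_OK_int | case: (w_pos k)].
have oMn z k : in_OK z -> in_OK (z *+ k).
  by move=> oz; rewrite -mulr_natl; apply: in_OKM => //; exact: in_OK_nat.
have oy : in_OK y.
  (* The coefficients of y are fractional; y is integral as a difference of integers. *)
  have -> : y = g - (x *+ c + \sum_k w k *+ f k) by rewrite gE addrC addKr.
  apply: in_OKB => //; apply: in_OKD; first exact: oMn.
  by apply: in_OK_sum => k _; apply: oMn; case: (w_pos k).
have sgx i : s i g = c%:R * s i x + \sum_k ratr (r k) * s i (w k).
  rewrite eq /x !rmorph_sum mulr_sumr -big_split; apply: eq_bigr => k _ /=.
  have {1}-> : q k = c%:R * (e k)%:~R + r k by rewrite /r; ring.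
  rewrite !rmorphM rmorph_alg_rat rmorphD rmorphM /= ratr_nat ratr_int rmorph_int.
  by ring.
have rw_ge0 i : 0 <= \sum_k ratr (r k) * s i (w k).
  by apply: sumr_ge0 => k _; rewrite mulr_ge0 ?ler0q // ltW.
have rw_le i : \sum_k ratr (r k) * s i (w k) <= c%:R * W.
  apply: (@le_trans _ _ (c%:R * \sum_k s i (w k))); last by rewrite ler_wpM2l // ltW.
  rewrite mulr_sumr; apply: ler_sum => k _; rewrite ler_wpM2r ?(ltW (w0 _ _)) //.
  by rewrite -(ratr_nat R) ler_rat ltW.
rewrite gE; apply: nat_spanD; first apply: nat_spanD.
- apply: nat_spanMn; apply: lE => // i; have /andP [g1 g2] := gS i.
    rewrite -(pmulr_rgt0 _ c_gt0).
    have : L * (c%:R * S0) <= L * S by rewrite ler_wpM2l // ltW.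
    by rewrite mulrCA LS0 mulrDr mulr1; have := rw_le i; have := sgx i; lra.
  rewrite -(ler_pM2l c_gt0) /B mulrDr.
  have : U * S <= U * (2%:R * c%:R * S0) by rewrite ler_wpM2l // ltW.
  have -> : U * (2%:R * c%:R * S0) = c%:R * (2%:R * U * S0) by ring.
  have : 0 <= c%:R * W by rewrite mulr_ge0 // ltW.
  by have := rw_ge0 i; have := sgx i; lra.
- apply: nat_span_sum => k; apply: nat_spanMn; have [ok pk] := w_pos k.
  apply: lE => // i; apply: le_trans WB.
  by apply: le_trans (W_ge i); rewrite (bigD1 k) //= lerDl sumr_ge0 // => j _; exact/ltW.
(* A vanishing y is not totally positive, but it is the empty sum. *)
have [y0|yN0] := eqVneq y 0; first by rewrite y0; exact: nat_span0.
have syE i : s i y = \sum_k ratr (h k) * s i (w k).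
  by rewrite rmorph_sum; apply: eq_bigr => k _; rewrite rmorphM rmorph_alg_rat.
apply: lE => // i.
  rewrite lt_neqAle eq_sym fmorph_eq0 yN0 syE sumr_ge0 // => k _.
  by have [h1 _] := h_bnd k; rewrite mulr_ge0 ?ler0q // ltW.
apply: le_trans WB.
apply: le_trans (W_ge i); rewrite syE; apply: ler_sum => k _.
have [_ h1] := h_bnd k; rewrite ler_piMl ?(ltW (w0 _ _)) //.
by rewrite -(rmorph1 (ratr : rat -> R)) ler_rat ltW.
Qed.

End Arithmetic.

(** * Assembly of the universal form *)

Theorem theorem4p7 (R : realType) (K : fieldExtType rat) (m : nat)
    (hK : totally_real R K) (hm : (2 < m)%N) (hm_even : ~~ odd m) :
  exists (n : nat) (Q : {mpoly K[n]}), universal_mic_form R m Q.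
Proof.
have m_gt0 : (0 < m)%N by apply: leq_trans hm.
have [d [th [s [d_gt0 th_int s_inj span s_all]]]] := real_embeddings hK.
have [L [U [L_gt0 U_gt0 bal]]] := balance d_gt0 th_int s_inj span m_gt0 hm_even.
have [l [l_pos l_span]] := balanced_decomposition d_gt0 th_int s_inj span L_gt0 U_gt0.
have [x /l_pos [ox px]|n [Q [Q_form Q_pos Q_rep]]] :=
  form_representing_combinations m_gt0 _ (form_representing_naturals R K m_gt0 hm_even) (s := l).
  (* Positivity under the s_i is positivity under every real embedding, as the s_i exhaust them. *)
  by split=> // t; have [i ->] := s_all t.
exists n, Q; split=> // a [oa a_pos].
have [e [g [S [oe og -> S_gt0 gS]]]] := bal a oa (fun i => a_pos (s i)).
apply: represents_scale oe _ => //; apply: Q_rep.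
have [c ->] := l_span g S og S_gt0 gS.
by exists (fun y => (c y)%:R); split=> // y; exists (c y).
Qed.
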